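(* There exists an absolute constant $C < 1$ such that, for any integer $r \geq 6$ and any function $p = p(n) \in [0,1]$, $$\tau^{(r-1)}\left(H_r(n,p)\right) \leq C\, r\, \nu^{(r-1)}\left(H_r(n,p)\right) \quad \text{with high probability.}$$ Furthermore, for every $\varepsilon > 0$ there is $r_0 = r_0(\varepsilon)$ such that, for all integers $r \geq r_0$ and all functions $p = p(n) \in [0,1]$, $$\tau^{(r-1)}\left(H_r(n,p)\right) \leq \left(\frac{1}{2} + \varepsilon\right) r\, \nu^{(r-1)}\left(H_r(n,p)\right) \quad \text{with high probability.}$$
   Context: An $r$-graph $G$ is a set of $r$-element subsets (edges) of a vertex set $V(G)$. An $(r-1)$-matching in $G$ is a set of edges of $G$ any two distinct members of which intersect in fewer than $r-1$ vertices; $\nu^{(r-1)}(G)$ is the maximum size of an $(r-1)$-matching in $G$. An $(r-1)$-cover of $G$ is a collection of $(r-1)$-element subsets of $V(G)$ such that every edge of $G$ contains at least one member of the collection; $\tau^{(r-1)}(G)$ is the minimum size of an $(r-1)$-cover of $G$. $H_r(n,p)$ denotes the random $r$-graph on a set $V$ of $n$ labelled vertices in which each $r$-element subset of $V$ is an edge with probability $p$, independently of the others. ''With high probability'' means with probability tending to $1$ as $n \to \infty$ (with $r$ and the function $p$ fixed). *)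

(* Defs.v *)
From mathcomp Require Import all_boot all_order all_algebra.
From mathcomp Require Import all_classical all_reals all_analysis.

Set Implicit Arguments.
Unset Strict Implicit.
Unset Printing Implicit Defensive.

Import Order.TTheory GRing.Theory Num.Theory.
Import numFieldNormedType.Exports.

Local Open Scope ring_scope.

Section Hypergraphs.
Variable V : finType.

Definition ksets (k : nat) : {set {set V}} := [set e : {set V} | #|e| == k].

(* A hypergraph on V is its edge set; it is an r-graph when G \subset ksets r. *)
Implicit Types (G M S : {set {set V}}) (k : nat).

Definition is_matching k G M : bool :=
  (M \subset G) &&
  [forall e in M, forall f in M, (e != f) ==> (#|e :&: f| < k)%N].

Definition is_cover k G S : bool :=
  (S \subset ksets k) && [forall e in G, exists s in S, s \subset e].

Definition nu k G : nat := \max_(M : {set {set V}} | is_matching k G M) #|M|.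

(* The default value ksets k is a cover as soon as every edge has at least k
   vertices, so for an r-graph and k <= r this is the true minimum (see tauP);
   the value is junk when no cover exists. *)
Definition tau k G : nat :=
  #|[arg min_(S < ksets k | is_cover k G S) #|S|]|.

Lemma tauP r k G : (k <= r)%N -> G \subset ksets r ->
  (exists2 S, is_cover k G S & #|S| = tau k G) /\
  (forall S, is_cover k G S -> (tau k G <= #|S|)%N).
Proof.
move=> lekr /fintype.subsetP Gr.
have cov : is_cover k G (ksets k).
  apply/andP; split=> //; apply/forall_inP => e /Gr; rewrite inE => /eqP er.
  have : (0 < #|[set s : {set V} | s \subset e & #|s| == k]|)%N.
    by rewrite cards_draws er bin_gt0.
  case/card_gt0P=> s; rewrite inE => /andP[se sk].
  by apply/exists_inP; exists s; rewrite ?inE.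
rewrite /tau; case: arg_minnP => // S covS minS.
by split; [exists S | exact: minS].
Qed.

End Hypergraphs.

Section RandomHypergraph.
Variable R : realType.

(* The law of H_r(n,p): meaningful only for G \subset ksets r, to which
   rgraph_prob restricts the sum. *)
Definition rgraph_weight (r n : nat) (p : R) (G : {set {set 'I_n}}) : R :=
  \prod_(e in ksets 'I_n r) (if e \in G then p else 1 - p).

Definition rgraph_prob (r n : nat) (p : R) (E : pred {set {set 'I_n}}) : R :=
  \sum_(G in powerset (ksets 'I_n r) | E G) rgraph_weight r p G.

Lemma rgraph_prob_total r n (p : R) :
  rgraph_prob r p (@predT {set {set 'I_n}}) = 1.
Proof.
rewrite /rgraph_prob /rgraph_weight; set A := ksets _ r.
pose F e : R := if e \in A then p else 0.
pose H e : R := if e \in A then 1 - p else 1.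
have FH1 : \prod_e (F e + H e) = 1.
  apply: big1 => e _; rewrite /F /H.
  by case: ifP => _; rewrite ?add0r // addrC subrK.
rewrite -[RHS]FH1 (@bigA_distr R 0 1 *%R +%R _ F H).
rewrite [RHS](bigID (fun J : {set {set 'I_n}} => J \subset A)) /=.
rewrite [X in _ = _ + X]big1 ?addr0 => [|J /fintype.subsetPn[e eJ eA]]; last first.
  by rewrite (bigD1 e) //= eJ /F (negbTE eA) mul0r.
apply: eq_big => [J|J]; first by rewrite powersetE andbT.
rewrite powersetE andbT => /fintype.subsetP JA.
rewrite big_mkcond; apply: eq_bigr => e _; rewrite /F /H.
by case: ifP => // /negP eA; case: ifP => // /JA.
Qed.

Definition whp (r : nat) (p : nat -> R)
    (E : forall n, pred {set {set 'I_n}}) : Prop :=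
  (rgraph_prob r (p n) (E n) @[n --> \oo] --> (1 : R))%classic.

End RandomHypergraph.

(* Main.v *)
Require Import Defs.
From mathcomp Require Import all_boot all_order all_algebra.
From mathcomp Require Import all_classical all_reals all_analysis.
From mathcomp Require Import ring lra zify.
Set Implicit Arguments.
Unset Strict Implicit.
Unset Printing Implicit Defensive.
Import Order.TTheory GRing.Theory Num.Theory.
Import numFieldNormedType.Exports.

Local Open Scope ring_scope.

(** Regard the [(r-1)]-sets of an [n]-set as the vertices, and the [r]-sets as the
    edges, of an auxiliary hypergraph. It is linear, [r]-uniform and regular of
    degree [D = n - r + 1]; [nu] is the matching number, and [tau] the vertex cover
    number, of a random set of its edges of density [p]. Everything but the
    existence of a small full cover is proved for all such hypergraphs with [D]
    large and with [D] small against the number [M] of vertices. Write [c = p D].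

    The matching number is bounded from below by the random greedy matching. If
    [u] is the fraction of vertices that it leaves uncovered, an edge is available
    with probability about [u ^ r], so that [u' = - u ^ r] as [c] grows, and
    [u ^ (r-1) (1 + (r-1) c) = 1]; the matching has about [(1 - u) M / r] edges
    ([Ex_matchnum_ge]). To make this rigorous the random set is exposed in many
    thin independent layers, of which only those consisting of one edge are used
    ([process_le_matchnum]). The resulting Markov chain has an exact one-step
    recursion for the mean of any function of the covered set. It shows that
    functions of disjoint sets of vertices have covariance [O(1/D)] ([cov_le]):
    linearity lets few edges meet both sets. Hence the vertices of an edge are
    nearly independent and the uncovered fraction follows the differential
    equation ([uncovered_euler], [euler_decay]).

    The cover number is bounded by the best of three covers ([mean_cover_cost]):
    one vertex of each edge, [c M / r] vertices on average; a random set
    of vertices of density [1 - theta u], completed by one vertex of each edge that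
    it misses, where the equation for [u] bounds the mean by
    [(1 - theta u + theta ^ r u / (r (r-1))) M] whatever [c] is; and a cover of all
    edges, of density [T]. For the last one colour the [n] points with [l + 1]
    colours and take the [(r-1)]-sets whose total colour is, modulo [l + 1], at
    most the number of colours that they miss, as Frankl and Rodl did
    ([small_cover]); this gives [T = 1/(l+1) + (1 - 1/(l+1)) ^ (r-1)].

    One more edge changes the matching number and the size of a completed cover by
    at most one, hence the Efron-Stein inequality concentrates both around their
    means; when too few edges are expected for that, they are likely to form a
    matching themselves ([few_failures]).

    It remains to choose [theta], [T], and the fraction [u1] below which the full
    cover is used ([cover_parameters]). For [r >= 6], [theta = 1 + 1/r] and two
    colours give a constant [1 - 1/(8 r)] ([parameters_ge6]). For large [r],
    [theta = 1 + ln (r/2) / r] and a full cover of density close to [ln r / r] give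
    [1/2 + eps] ([parameters_large]); with [eps = 1/8] this leaves finitely many
    [r] to the first choice and makes the constant [C < 1] independent of [r]. *)

(** * Expectation over a random subset *)

Section RandomSubset.
Variables (R : realType) (E : finType).
Implicit Types (p q : R) (s : seq E) (F : {set E} -> R) (G : {set E}).

(** The expectation of [F] over the random subset of [s] that contains each entry
    with probability [p], in a form suited to induction on the entries; [ExE]
    relates it to the product measure. *)
Fixpoint Ex p s F : R :=
  if s is e :: s' then p * Ex p s' (fun G => F (e |: G)) + (1 - p) * Ex p s' F
  else F finset.set0.

Lemma eq_Ex p s F1 F2 : F1 =1 F2 -> Ex p s F1 = Ex p s F2.
Proof.
elim: s F1 F2 => [|e s IH] F1 F2 eqF /=; first by rewrite eqF.
by rewrite (IH _ _ eqF) (IH _ (fun G => F2 (e |: G))) // => G; rewrite eqF.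
Qed.

Lemma Ex_cst p s a : Ex p s (fun=> a) = a.
Proof. by elim: s => //= e s ->; rewrite -mulrDl addrC subrK mul1r. Qed.

Lemma ExD p s F1 F2 : Ex p s (fun G => F1 G + F2 G) = Ex p s F1 + Ex p s F2.
Proof.
elim: s F1 F2 => [|e s IH] F1 F2 //=; rewrite !IH; ring.
Qed.

Lemma ExZ p s a F : Ex p s (fun G => a * F G) = a * Ex p s F.
Proof. by elim: s F => [|e s IH] F //=; rewrite !IH; ring. Qed.

Lemma ExB p s F1 F2 : Ex p s (fun G => F1 G - F2 G) = Ex p s F1 - Ex p s F2.
Proof.
rewrite -[- Ex p s F2]mulN1r -ExZ -ExD; apply: eq_Ex => G; by rewrite mulN1r.
Qed.

Lemma Ex_sum p s (I : finType) (P : pred I) (F : I -> {set E} -> R) :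
  Ex p s (fun G => \sum_(i | P i) F i G) = \sum_(i | P i) Ex p s (F i).
Proof.
elim: s F => [|e s IH] F //=.
by rewrite !IH !mulr_sumr -big_split.
Qed.

Lemma le_Ex p s F1 F2 : 0 <= p <= 1 ->
  (forall G, {subset G <= s} -> F1 G <= F2 G) -> Ex p s F1 <= Ex p s F2.
Proof.
move=> /andP[p0 p1]; elim: s F1 F2 => [|e s IH] F1 F2 leF /=.
  by apply: leF => x; rewrite inE.
apply: lerD; apply: ler_wpM2l; rewrite ?subr_ge0 //; apply: IH => G Gs.
  apply: leF => x /setU1P[->|/Gs xs]; rewrite in_cons ?eqxx // xs orbT //.
by apply: leF => x /Gs; rewrite in_cons => ->; rewrite orbT.
Qed.

Lemma Ex0 s F : Ex 0 s F = F finset.set0.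
Proof. by elim: s F => [|e s IH] F //=; rewrite !IH; ring. Qed.

(** The union of two independent random subsets is again a random subset; this
    is what lets the random hypergraph be exposed in many thin layers. *)
Lemma Ex_union p q s F :
  Ex (1 - (1 - p) * (1 - q)) s F = Ex p s (fun G => Ex q s (fun G' => F (G :|: G'))).
Proof.
elim: s F => [|e s IH] F /=; first by rewrite finset.setU0.
rewrite !ExD !ExZ !IH.
have -> : Ex p s (fun G => Ex q s (fun G' => F ((e |: G) :|: (e |: G')))) =
          Ex p s (fun G => Ex q s (fun G' => F (e |: (G :|: G')))).
  apply: eq_Ex => G; apply: eq_Ex => G'; congr F.
  by apply/setP=> x; rewrite !inE; case: (x == e); rewrite ?orbT.
have -> : Ex p s (fun G => Ex q s (fun G' => F ((e |: G) :|: G'))) =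
          Ex p s (fun G => Ex q s (fun G' => F (e |: (G :|: G')))).
  by apply: eq_Ex => G; apply: eq_Ex => G'; rewrite finset.setUA.
have -> : Ex p s (fun G => Ex q s (fun G' => F (G :|: (e |: G')))) =
          Ex p s (fun G => Ex q s (fun G' => F (e |: (G :|: G')))).
  by apply: eq_Ex => G; apply: eq_Ex => G'; rewrite finset.setUCA.
by ring.
Qed.

Definition subset_monotone F := forall G G', G \subset G' -> F G <= F G'.

Lemma monotone_setU1 F e : subset_monotone F -> subset_monotone (fun G => F (e |: G)).
Proof. by move=> mF G G' GG'; apply: mF; apply: finset.setUS. Qed.

Lemma Ex_ge_set0 p s F : 0 <= p <= 1 -> subset_monotone F -> F finset.set0 <= Ex p s F.
Proof.
move=> p01 mF; rewrite -(Ex_cst p s (F finset.set0)).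
by apply: le_Ex => // G _; apply: mF; apply: finset.sub0set.
Qed.

(** The outcomes with two or more selected elements contribute at least
    [F set0], so that only those with a single element remain. *)
Lemma Ex_ge_single q s F : 0 <= q <= 1 -> subset_monotone F ->
  F finset.set0 + q * (1 - q) ^+ size s * \sum_(e <- s) (F [set e] - F finset.set0)
    <= Ex q s F.
Proof.
move=> q01; have /andP[q0 q1] := q01.
elim: s F => [|e s IH] F mF /=; first by rewrite big_nil mulr0 addr0.
have h1 := Ex_ge_set0 s q01 (@monotone_setU1 F e mF).
rewrite /= finset.setU0 in h1.
have h2 := IH F mF.
rewrite big_cons exprS.
set S := \sum_(_ <- _) _ in h2 *; set w := (1 - q) ^+ size s in h2 *.
have w0 : 0 <= w by rewrite exprn_ge0 // subr_ge0.
have w1 : w <= 1 by rewrite exprn_ile1 // ?subr_ge0 // gerBl.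
have dF : 0 <= F [set e] - F finset.set0 by rewrite subr_ge0; apply: mF; apply: finset.sub0set.
have h3 : q * F [set e] <= q * Ex q s (fun G => F (e |: G)) by rewrite ler_wpM2l.
have h4 : (1 - q) * (F finset.set0 + q * w * S) <= (1 - q) * Ex q s F.
  by rewrite ler_wpM2l // subr_ge0.
have h5 : q * ((1 - q) * w) * (F [set e] - F finset.set0) <= q * (F [set e] - F finset.set0).
  apply: ler_wpM2r => //; rewrite -[leRHS]mulr1 ler_wpM2l //.
  by rewrite mulr_ile1 // ?subr_ge0 // gerBl.
apply: le_trans (lerD h3 h4); rewrite mulrDr.
by rewrite -subr_ge0 in h5; rewrite -subr_ge0; apply: le_trans h5 _; rewrite le_eqVlt; apply/orP; left; apply/eqP; ring.
Qed.

Lemma Ex_mono_p p p' s F : 0 <= p -> p <= p' -> p' <= 1 -> subset_monotone F ->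
  Ex p s F <= Ex p' s F.
Proof.
move=> p0 pp' p'1 mF.
have [p1|p1] := eqVneq p 1.
  by have -> : p' = p by apply/eqP; rewrite eq_le pp' p1 p'1.
have lp : 0 < 1 - p by rewrite subr_gt0 lt_neqAle p1 (le_trans pp').
pose q := (p' - p) / (1 - p).
have q0 : 0 <= q by apply: divr_ge0; [rewrite subr_ge0 | exact: ltW].
have q1 : q <= 1 by rewrite ler_pdivrMr // mul1r lerD2r.
have -> : p' = 1 - (1 - p) * (1 - q).
  by rewrite /q; field; rewrite gt_eqF.
rewrite Ex_union; apply: le_Ex; first by rewrite p0 (le_trans pp').
move=> G _.
apply: (@le_trans _ _ (Ex q s (fun=> F G))); first by rewrite Ex_cst.
apply: le_Ex; first by rewrite q0.
by move=> G' _; apply: mF; apply: finset.subsetUl.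
Qed.

Lemma Ex_card p s (P : pred E) : uniq s ->
  Ex p s (fun G => #|[set e in G | P e]|%:R) = p * (count P s)%:R.
Proof.
have cardP (G : {set E}) : #|[set e in G | P e]|%:R = \sum_(e | P e) (e \in G)%:R :> R.
  rewrite -sum1_card natr_sum big_mkcond [RHS]big_mkcond; apply: eq_bigr => e _.
  by rewrite inE; case: (e \in G); case: (P e).
move=> us; rewrite (eq_Ex _ _ cardP) Ex_sum.
have Ein e : Ex p s (fun G => (e \in G)%:R) = p * (e \in s)%:R.
  elim: s us => [|x s IH] /=; first by rewrite inE mulr0.
  move=> /andP[xs us]; rewrite IH // in_cons.
  have [->|ne] := eqVneq e x => /=.
    rewrite (eq_Ex _ _ (F2 := fun=> 1)); last by move=> G; rewrite setU11.
    by rewrite Ex_cst (negbTE xs) /=; ring.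
  rewrite (eq_Ex _ _ (F2 := fun G => (e \in G)%:R)).
    by rewrite IH //; ring.
  by move=> G; rewrite in_setU1 (negbTE ne).
rewrite (eq_bigr _ (fun e _ => Ein e)) -mulr_sumr; congr (_ * _).
rewrite -sum1_count [in RHS]big_mkcond /= big_uniq //= natr_sum.
rewrite [LHS]big_mkcond [RHS]big_mkcond; apply: eq_bigr => e _.
by case: (P e); case: (e \in s).
Qed.

Definition edge_lipschitz (k : R) F := forall e G, `|F (e |: G) - F G| <= k.

Lemma Ex_norm_le p s k F : 0 <= p <= 1 -> (forall G, `|F G| <= k) -> `|Ex p s F| <= k.
Proof.
move=> p01 Fk; rewrite ler_norml; apply/andP; split.
  rewrite -(Ex_cst p s (- k)); apply: le_Ex => // G _.
  by have := Fk G; rewrite ler_norml => /andP[].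
rewrite -(Ex_cst p s k); apply: le_Ex => // G _.
by have := Fk G; rewrite ler_norml => /andP[].
Qed.

(** The Efron-Stein inequality: conditioning on the first coordinate splits the
    variance into the mean conditional variance and the variance of a two-valued
    variable whose values differ by at most [k]. *)
Lemma Ex_variance p s k F : 0 <= p <= 1 -> edge_lipschitz k F ->
  Ex p s (fun G => (F G - Ex p s F) ^+ 2) <= (size s)%:R * p * k ^+ 2.
Proof.
move=> p01; have /andP[p0 p1] := p01.
have varE s' F' m : Ex p s' (fun G => (F' G - m) ^+ 2) =
    Ex p s' (fun G => (F' G - Ex p s' F') ^+ 2) + (Ex p s' F' - m) ^+ 2.
  set m' := Ex p s' F'.
  rewrite (@eq_Ex _ _ _ (fun G => (F' G - m') ^+ 2 + ((2 * (m' - m)) * F' G +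
      (m ^+ 2 - m' ^+ 2)))); last by move=> G; ring.
  by rewrite ExD ExD ExZ Ex_cst -/m'; ring.
elim: s F => [|e s IH] F lF.
  by rewrite /= mul0r mul0r subrr expr0n.
have lF1 : edge_lipschitz k (fun G => F (e |: G)).
  by move=> x G; rewrite finset.setUCA; apply: lF.
have := IH _ lF; have := IH _ lF1.
rewrite /=.
set m1 := Ex p s (fun G => F (e |: G)); set m0 := Ex p s F.
set V1 := Ex p s (fun G => (F (e |: G) - m1) ^+ 2).
set V0 := Ex p s (fun G => (F G - m0) ^+ 2) => hV1 hV0.
rewrite (varE s (fun G => F (e |: G)) (p * m1 + (1 - p) * m0)).
rewrite (varE s F (p * m1 + (1 - p) * m0)) -/m1 -/m0 -/V1 -/V0.
have dm : `|m1 - m0| <= k by rewrite -ExB; apply: Ex_norm_le => // G; apply: lF.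
have dm2 : (m1 - m0) ^+ 2 <= k ^+ 2.
  by rewrite -real_normK ?num_real // lerXn2r ?nnegrE ?(le_trans _ dm).
have -> : p * (V1 + (m1 - (p * m1 + (1 - p) * m0)) ^+ 2) +
  (1 - p) * (V0 + (m0 - (p * m1 + (1 - p) * m0)) ^+ 2) =
  p * V1 + (1 - p) * V0 + p * ((1 - p) * (m1 - m0) ^+ 2) by ring.
have -> : (size s).+1%:R * p * k ^+ 2 =
  p * ((size s)%:R * p * k ^+ 2) + (1 - p) * ((size s)%:R * p * k ^+ 2) + p * k ^+ 2.
  by rewrite -natr1; ring.
apply: lerD; first by apply: lerD; apply: ler_wpM2l; rewrite ?subr_ge0.
apply: ler_wpM2l => //; apply: le_trans dm2.
by apply: ler_piMl; rewrite ?sqr_ge0 // gerBl.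
Qed.

(** A positive value of [F] exceeds its mean by [m] at least, so Chebyshev's
    inequality applies with the variance bound above. *)
Lemma Ex_chebyshev p s k m F : 0 <= p <= 1 -> edge_lipschitz k F ->
  0 < m -> Ex p s F <= - m ->
  Ex p s (fun G => (0 < F G)%R%:R) <= (size s)%:R * p * k ^+ 2 / m ^+ 2.
Proof.
move=> p01 lF m0 Fm; have V := Ex_variance s p01 lF; set mu := Ex p s F in Fm V.
rewrite ler_pdivlMr ?exprn_gt0 // [leLHS]mulrC -ExZ; apply: le_trans V.
apply: le_Ex => // G _; case: ltP => /= [F0|_]; last by rewrite mulr0 sqr_ge0.
by rewrite mulr1 lerXn2r ?nnegrE; lra.
Qed.

Lemma ExE p (A : {set E}) F :
  \sum_(G in powerset A) (\prod_(e in A) (if e \in G then p else 1 - p)) * F G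
  = Ex p (enum A) F.
Proof.
rewrite -{1 2}(set_enum A); have := enum_uniq A; move: (enum A) => s.
elim: s F => [|e s IH] F /=.
  move=> _; have -> : [set:: [::] : seq E] = finset.set0 by apply/setP=> x; rewrite !inE.
  by rewrite finset.powerset0 big_set1 big_set0 mul1r.
move=> /andP[es us]; rewrite -!IH //.
set A' := [set:: s]; have eA : e \notin A' by rewrite inE.
have -> : [set:: e :: s] = e |: A' by apply/setP=> x; rewrite !inE.
rewrite (bigID (fun G => e \in G)) /=; congr (_ + _).
  rewrite (reindex_onto (fun G => e |: G) (fun G => G :\ e)) /=; last first.
    by move=> G /andP[_ eG]; rewrite finset.setD1K.
  rewrite mulr_sumr; apply: eq_big => [G|G].
    rewrite !inE eqxx orTb andbT.
    apply/andP/idP => [[sG /eqP eG]|sG].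
      have eG' : e \notin G by rewrite -eG !inE eqxx.
      by rewrite -(finset.setU1K eG') -(finset.setU1K eA) finset.setSD.
    split; first by apply: finset.setUS.
    by apply/eqP/finset.setU1K; apply: contra eA; apply: (fintype.subsetP sG).
  rewrite big_setU1 //= setU11 -!mulrA => _; congr (_ * (_ * _)).
  apply: eq_bigr => x xA; rewrite in_setU1.
  by have [xe|//] := eqVneq x e; rewrite xe (negbTE eA) in xA.
rewrite mulr_sumr; apply: eq_big => [G|G].
  rewrite !powersetE; apply/andP/idP => [[sG eG]|sG].
    by rewrite -(finset.setU1K eA) finset.subsetD1 sG.
  split; first by apply: fintype.subset_trans sG (finset.subsetUr _ _).
  by apply: contra eA; apply: (fintype.subsetP sG).
by move=> /andP[_ eG]; rewrite big_setU1 //= (negbTE eG) -!mulrA.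
Qed.

End RandomSubset.

(** * The lazy random greedy matching *)

(** Edges are abstract, with vertex sets given by [del]; linearity is the bound by
    one of the codegrees. *)
Record linear_regular (V E : finType) (s : seq E) (del : E -> {set V})
    (X : {set V}) (r D : nat) : Prop := LinearRegular {
  lr_uniq : uniq s;
  lr_sub : forall e, e \in s -> del e \subset X;
  lr_card : forall e, e \in s -> #|del e| = r;
  lr_linear : forall v w, v != w ->
    (count (fun e => (v \in del e) && (w \in del e)) s <= 1)%N;
  lr_degree : forall v, v \in X -> count (fun e => v \in del e) s = D }.

Lemma sum_count (R : realType) (E : eqType) (s : seq E) (P : pred E) :
  \sum_(e <- s) (P e)%:R = (count P s)%:R :> R.
Proof.
by elim: s => [|e s IH]; rewrite ?big_nil // big_cons IH /= natrD.
Qed.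

Section LinearRegular.
Variables (R : realType) (V E : finType) (s : seq E) (del : E -> {set V}).
Variables (X : {set V}) (r D : nat).
Hypothesis lr : linear_regular s del X r D.
Implicit Types (C W : {set V}).

Definition hits W e := ~~ [disjoint del e & W].

Lemma degree_le v : (count (fun e => v \in del e) s <= D)%N.
Proof.
have [vX|vX] := boolP (v \in X); first by rewrite (lr_degree lr vX).
rewrite (_ : count _ _ = 0%N) //; apply/eqP; rewrite eqn0Ngt -has_count.
apply/hasPn => e es; apply: contra vX => ve.
exact: (fintype.subsetP (lr_sub lr es)).
Qed.

Lemma le_count_sum (P : pred E) W (Q : V -> pred E) :
  (forall e, P e -> exists2 v, v \in W & Q v e) ->
  (count P s <= \sum_(v in W) count (Q v) s)%N.
Proof.
move=> PQ; under eq_bigr do rewrite -sum1_count big_mkcond /=.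
rewrite -sum1_count big_mkcond exchange_big /=; apply: leq_sum => e _.
case: ifP => // /PQ[v vW Qve].
by rewrite (bigD1 v) //= Qve leq_addr.
Qed.

Lemma count_hits W : (count (hits W) s <= D * #|W|)%N.
Proof.
apply: (@leq_trans (\sum_(v in W) count (fun e => v \in del e) s)).
  apply: le_count_sum => e /pred0Pn[v /andP[ve vW]].
  by exists v.
rewrite mulnC -sum_nat_const; apply: leq_sum => v _; exact: degree_le.
Qed.

Lemma count_hits2 W W' : [disjoint W & W'] ->
  (count (fun e => hits W e && hits W' e) s <= #|W| * #|W'|)%N.
Proof.
move=> dW.
apply: (@leq_trans (\sum_(v in W) count (fun e => (v \in del e) && hits W' e) s)).
  apply: le_count_sum => e /andP[/pred0Pn[v /andP[ve vW]] h'].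
  by exists v => //; apply/andP.
rewrite -sum_nat_const; apply: leq_sum => v vW.
apply: (@leq_trans (\sum_(w in W') count (fun e => (v \in del e) && (w \in del e)) s)).
  apply: le_count_sum => e /andP[ve /pred0Pn[w /andP[we wW]]].
  by exists w => //; apply/andP.
rewrite -sum1_card; apply: leq_sum => w wW; apply: (lr_linear lr).
by apply: contraL wW => /eqP <-; rewrite (disjointFr dW vW).
Qed.

Variable rho : R.
Hypothesis rho_ge0 : 0 <= rho.
Hypothesis rho_small : rho * (size s)%:R <= 1.

Definition cover_edge e C := if [disjoint del e & C] then del e :|: C else C.

(** One step of the process: each edge is proposed with probability [rho], no
    edge with the remaining probability, and a proposed edge is accepted when all
    its vertices are uncovered. The process is encoded by its Markov operator,
    acting on functions of the set of covered vertices. *)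
Definition step (F : {set V} -> R) C :=
  F C + rho * \sum_(e <- s) (F (cover_edge e C) - F C).

Definition mu j (F : {set V} -> R) := iter j step F finset.set0.

Lemma mu_step j F : mu j.+1 F = mu j (step F).
Proof. by rewrite /mu iterSr. Qed.

Lemma step_convex F C : step F C =
  (1 - rho * (size s)%:R) * F C + rho * \sum_(e <- s) F (cover_edge e C).
Proof.
rewrite /step sumrB big_const_seq count_predT iter_addr_0 -[F C *+ _]mulr_natr.
by ring.
Qed.

Lemma le_step F1 F2 : (forall C, F1 C <= F2 C) -> forall C, step F1 C <= step F2 C.
Proof.
move=> leF C; rewrite !step_convex; apply: lerD.
  by apply: ler_wpM2l; rewrite ?subr_ge0.
by apply: ler_wpM2l => //; apply: ler_sum => e _.
Qed.

Lemma le_mu j F1 F2 : (forall C, F1 C <= F2 C) -> mu j F1 <= mu j F2.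
Proof.
move=> leF; rewrite /mu; move: finset.set0.
by elim: j => //= j IH C; apply: le_step.
Qed.

Lemma mu_cst j a : mu j (fun=> a) = a.
Proof.
elim: j => // j IH; rewrite mu_step -[RHS]IH; congr mu; apply/funext => C.
by rewrite /step big1 ?mulr0 ?addr0 // => e _; rewrite subrr.
Qed.

Lemma muD j F1 F2 : mu j (fun C => F1 C + F2 C) = mu j F1 + mu j F2.
Proof.
elim: j F1 F2 => // j IH F1 F2; rewrite !mu_step -IH; congr mu; apply/funext => C.
rewrite /step !sumrB !big_split /=; ring.
Qed.

Lemma muZ j a F : mu j (fun C => a * F C) = a * mu j F.
Proof.
elim: j F => // j IH F; rewrite !mu_step -IH; congr mu; apply/funext => C.
by rewrite /step !sumrB -!mulr_sumr; ring.
Qed.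

Lemma mu_sum j (I : eqType) (t : seq I) (P : pred I) (F : I -> {set V} -> R) :
  mu j (fun C => \sum_(i <- t | P i) F i C) = \sum_(i <- t | P i) mu j (F i).
Proof.
elim: t => [|i t IH].
  rewrite big_nil -[RHS](mu_cst j 0); congr mu; apply/funext => C.
  by rewrite big_nil.
rewrite big_cons; case: ifP => Pi; last first.
  by rewrite -IH; congr mu; apply/funext => C; rewrite big_cons Pi.
by rewrite -IH -muD; congr mu; apply/funext => C; rewrite big_cons Pi.
Qed.

Lemma muB j F1 F2 : mu j (fun C => F1 C - F2 C) = mu j F1 - mu j F2.
Proof.
rewrite -[- mu j F2]mulN1r -muZ -muD; congr mu; apply/funext => C.
by rewrite mulN1r.
Qed.

Lemma mu_recE j F :
  mu j.+1 F = mu j F + rho * \sum_(e <- s) (mu j (fun C => F (cover_edge e C)) - mu j F).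
Proof.
rewrite mu_step /step muD muZ mu_sum; congr (_ + _ * _).
by apply: eq_bigr => e _; rewrite muB.
Qed.

Definition depends_on W (F : {set V} -> R) := forall C, F C = F (C :&: W).

Lemma depends_on_miss W F e C : depends_on W F -> ~~ hits W e ->
  F (cover_edge e C) = F C.
Proof.
move=> dF; rewrite negbK => dW; rewrite /cover_edge; case: ifP => // _.
rewrite dF [RHS]dF; congr F; apply/setP=> v; rewrite !inE.
by case: (boolP (v \in W)) => vW; rewrite ?andbF // (disjointFl dW).
Qed.

Lemma depends_on_cover W F e : depends_on W F ->
  depends_on (W :|: del e) (fun C => F (cover_edge e C)).
Proof.
move=> dF C; rewrite /cover_edge.
have -> : [disjoint del e & C :&: (W :|: del e)] = [disjoint del e & C].
  rewrite -!setI_eq0; congr (_ == _); apply/setP=> v; rewrite !inE.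
  by case: (v \in del e); rewrite ?andbF //= orbT andbT.
case: ifP => _; rewrite dF [RHS]dF; congr F; apply/setP=> v; rewrite !inE;
by case: (v \in del e); case: (v \in W); rewrite ?andbF ?andbT ?orbT.
Qed.

Let h := rho * D%:R.

Lemma h_ge0 : 0 <= h. Proof. by rewrite mulr_ge0. Qed.

(** A supersolution of the recursion satisfied by the covariances: see
    [beta_step]. *)
Definition beta j : R := (1 + 2 * h * r%:R) ^+ j * (j%:R * (3 * rho + h ^+ 2)).

Lemma growth_ge1 a : 0 <= a -> 1 <= 1 + a * h * r%:R.
Proof. by move=> a0; rewrite lerDl !mulr_ge0 ?h_ge0. Qed.

Lemma beta_ge0 j : 0 <= beta j.
Proof.
have h0 := h_ge0; rewrite mulr_ge0 ?exprn_ge0 ?(le_trans ler01 (growth_ge1 _)) //.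
by rewrite mulr_ge0 // addr_ge0 ?sqr_ge0 // mulr_ge0.
Qed.

Lemma beta_step j : (1 + 2 * h * r%:R) * beta j + (3 * rho + h ^+ 2) <= beta j.+1.
Proof.
rewrite /beta; set g := 1 + _; set x := 3 * rho + _.
have x0 : 0 <= x by rewrite addr_ge0 ?sqr_ge0 // mulr_ge0.
have g1 : 1 <= g ^+ j.+1 by rewrite exprn_ege1 // growth_ge1.
have -> : g ^+ j.+1 * (j.+1%:R * x) = g * (g ^+ j * (j%:R * x)) + g ^+ j.+1 * x.
  by rewrite -natr1 exprS; ring.
by rewrite lerD2l -[leLHS]mul1r ler_wpM2r.
Qed.

Lemma le_beta i j : (i <= j)%N -> beta i <= beta j.
Proof.
move=> /subnK <-; elim: (j - i)%N => [|k IH] //=; rewrite addSn.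
apply: le_trans (beta_step _); apply: le_trans IH _.
have h0 := h_ge0; set b := beta _; have b0 : 0 <= b by apply: beta_ge0.
apply: (@le_trans _ _ ((1 + 2 * h * r%:R) * b)).
  by rewrite -[leLHS]mul1r ler_wpM2r // growth_ge1.
by rewrite lerDl addr_ge0 ?sqr_ge0 // mulr_ge0.
Qed.

Definition unit_valued (F : {set V} -> R) := forall C, 0 <= F C <= 1.

Lemma mu_unit j F : unit_valued F -> 0 <= mu j F <= 1.
Proof.
move=> uF; apply/andP; split.
  by rewrite -(mu_cst j 0); apply: le_mu => C; case/andP: (uF C).
by rewrite -(mu_cst j 1); apply: le_mu => C; case/andP: (uF C).
Qed.

Lemma unit_dist (x y : R) : 0 <= x <= 1 -> 0 <= y <= 1 -> `|x - y| <= 1.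
Proof. by move=> /andP[? ?] /andP[? ?]; rewrite ler_norml; apply/andP; split; lra. Qed.

Lemma unit_mul (x y : R) : 0 <= x <= 1 -> 0 <= y <= 1 -> 0 <= x * y <= 1.
Proof. by move=> /andP[? ?] /andP[? ?]; rewrite mulr_ge0 //= mulr_ile1. Qed.

Lemma mu_cover_dist j W F : unit_valued F -> depends_on W F ->
  `|\sum_(e <- s) (mu j (fun C => F (cover_edge e C)) - mu j F)| <= D%:R * #|W|%:R.
Proof.
move=> uF dF; apply: le_trans (ler_norm_sum _ _ _) _.
rewrite -natrM; apply: (@le_trans _ _ (count (hits W) s)%:R); last first.
  by rewrite ler_nat count_hits.
rewrite -sum_count; apply: ler_sum => e _.
have [he|he] := boolP (hits W e).
  by apply: unit_dist; apply: mu_unit => C; apply: uF.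
have -> : (fun C => F (cover_edge e C)) = F.
  by apply/funext => C; apply: depends_on_miss he.
by rewrite subrr normr0.
Qed.

Definition cov j (F1 F2 : {set V} -> R) := mu j (fun C => F1 C * F2 C) - mu j F1 * mu j F2.

(** Propagation of chaos: functions of disjoint sets of vertices are nearly
    uncorrelated. Passing to the next step, an edge that meets only one of the two
    sets turns a covariance into another one, with that set enlarged by [r]
    vertices at most; by linearity no more than [#|W1| * #|W2|] edges meet both
    sets, and these are the only source of error, besides a second order term. *)
Lemma cov_le j W1 W2 F1 F2 : [disjoint W1 & W2] ->
  depends_on W1 F1 -> depends_on W2 F2 -> unit_valued F1 -> unit_valued F2 ->
  `|cov j F1 F2| <= beta j * (#|W1|%:R * #|W2|%:R).
Proof.
elim: j W1 W2 F1 F2 => [|j IH] W1 W2 F1 F2 dW dF1 dF2 uF1 uF2.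
  rewrite /cov /mu /= subrr normr0; apply: mulr_ge0; first exact: (beta_ge0 0).
  exact: mulr_ge0.
pose A e := mu j (fun C => F1 (cover_edge e C)) - mu j F1.
pose B e := mu j (fun C => F2 (cover_edge e C)) - mu j F2.
pose T e := mu j (fun C => F1 (cover_edge e C) * F2 (cover_edge e C)) -
  mu j (fun C => F1 C * F2 C) - A e * mu j F2 - mu j F1 * B e.
have covE : cov j.+1 F1 F2 = cov j F1 F2 + rho * (\sum_(e <- s) T e) -
    (rho * \sum_(e <- s) A e) * (rho * \sum_(e <- s) B e).
  rewrite /cov !mu_recE -/A -/B.
  have -> : \sum_(e <- s) T e = \sum_(e <- s)
    (mu j (fun C => F1 (cover_edge e C) * F2 (cover_edge e C)) - mu j (fun C => F1 C * F2 C))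
     - (\sum_(e <- s) A e) * mu j F2 - mu j F1 * \sum_(e <- s) B e.
    by rewrite mulr_suml mulr_sumr -!sumrB.
  set SA := \sum_(_ <- _) A _; set SB := \sum_(_ <- _) B _; rewrite -/SA -/SB.
  by ring.
pose n1 := count (fun e => hits W1 e && ~~ hits W2 e) s.
pose n2 := count (fun e => ~~ hits W1 e && hits W2 e) s.
pose n12 := count (fun e => hits W1 e && hits W2 e) s.
set t1 : R := #|W1|%:R; set t2 : R := #|W2|%:R.
have hA := mu_cover_dist j uF1 dF1; have hB := mu_cover_dist j uF2 dF2.
rewrite -/t1 -/t2 -/(A _) -/(B _) in hA hB.
have b0 := beta_ge0 j; set b := beta j in b0 *.
have t10 : 0 <= t1 by []. have t20 : 0 <= t2 by [].
have icov := IH _ _ _ _ dW dF1 dF2 uF1 uF2; rewrite -/t1 -/t2 -/b in icov.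
have missE (F : {set V} -> R) W e : depends_on W F -> ~~ hits W e ->
    (fun C => F (cover_edge e C)) = F.
  by move=> dF he; apply/funext => C; apply: depends_on_miss he.
have cardU e W : e \in s -> #|W :|: del e|%:R <= #|W|%:R + r%:R :> R.
  move=> es; rewrite -natrD ler_nat -(lr_card lr es) cardsU; exact: leq_subr.
have Te e : e \in s ->
    `|T e + (hits W1 e (+) hits W2 e)%:R * cov j F1 F2| <=
    (hits W1 e && ~~ hits W2 e)%:R * (b * ((t1 + r%:R) * t2)) +
    (~~ hits W1 e && hits W2 e)%:R * (b * (t1 * (t2 + r%:R))) +
    (hits W1 e && hits W2 e)%:R * 3.
  move=> es; rewrite /T /A /B /cov.
  case: (boolP (hits W1 e)) => h1; case: (boolP (hits W2 e)) => h2 /=;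
    rewrite ?mul0r ?mul1r ?add0r ?addr0.
  - have u1 : unit_valued (fun C => F1 (cover_edge e C)) by move=> C; apply: uF1.
    have u2 : unit_valued (fun C => F2 (cover_edge e C)) by move=> C; apply: uF2.
    have := unit_dist (mu_unit j (fun C => unit_mul (u1 C) (u2 C)))
      (mu_unit j (fun C => unit_mul (uF1 C) (uF2 C))).
    have := unit_dist (mu_unit j u1) (mu_unit j uF1).
    have := unit_dist (mu_unit j u2) (mu_unit j uF2).
    have /andP[m10 m11] := mu_unit j uF1; have /andP[m20 m21] := mu_unit j uF2.
    set x := _ - _; set y := _ - _; set z := _ - _ => hx hy hz.
    apply: le_trans (ler_normB _ _) _; rewrite normrM (ger0_norm m10).
    have := ler_piMl (normr_ge0 x) m11.
    have := ler_normB z (y * mu j F2); rewrite normrM (ger0_norm m20).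
    have := ler_piMr (normr_ge0 y) m21; lra.
  - have -> : (fun C => F1 (cover_edge e C) * F2 (cover_edge e C)) =
        (fun C => F1 (cover_edge e C) * F2 C).
      by apply/funext => C; rewrite (depends_on_miss C dF2 h2).
    rewrite (missE _ _ _ dF2 h2) subrr mulr0 subr0.
    have dW' : [disjoint W1 :|: del e & W2].
      by rewrite finset.disjoints_subset finset.subUset -!finset.disjoints_subset dW -[X in _ && X]negbK.
    have := IH _ _ _ _ dW' (depends_on_cover e dF1) dF2 (fun C => uF1 _) uF2.
    rewrite /cov -/b -/t2.
    set x := mu _ _; set y := mu _ _; set z := mu _ _ => hx.
    rewrite [X in `|X|](_ : _ = x - y * z); last by rewrite /y /z; ring.
    apply: le_trans hx _; apply: ler_wpM2l => //; apply: ler_wpM2r => //.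
    exact: cardU.
  - have -> : (fun C => F1 (cover_edge e C) * F2 (cover_edge e C)) =
        (fun C => F1 C * F2 (cover_edge e C)).
      by apply/funext => C; rewrite (depends_on_miss C dF1 h1).
    rewrite (missE _ _ _ dF1 h1) subrr mul0r subr0.
    have dW' : [disjoint W1 & W2 :|: del e].
      rewrite disjoint_sym finset.disjoints_subset finset.subUset -!finset.disjoints_subset.
      by rewrite disjoint_sym dW -[X in _ && X]negbK.
    have := IH _ _ _ _ dW' dF1 (depends_on_cover e dF2) uF1 (fun C => uF2 _).
    rewrite /cov -/b -/t1.
    set x := mu _ _; set y := mu _ _; set z := mu _ _ => hx.
    rewrite [X in `|X|](_ : _ = x - y * z); last by rewrite /y /z; ring.
    by apply: le_trans hx _; apply: ler_wpM2l => //; apply: ler_wpM2l => //; apply: cardU.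
  - have -> : (fun C => F1 (cover_edge e C) * F2 (cover_edge e C)) = (fun C => F1 C * F2 C).
      apply/funext => C.
      by rewrite (depends_on_miss C dF1 h1) (depends_on_miss C dF2 h2).
    rewrite (missE _ _ _ dF1 h1) (missE _ _ _ dF2 h2).
    by rewrite !subrr mul0r mulr0 !subr0 normr0.
have n1le : n1%:R <= D%:R * t1.
  rewrite -natrM ler_nat; apply: leq_trans (count_hits W1).
  by apply: sub_count => e /andP[].
have n2le : n2%:R <= D%:R * t2.
  rewrite -natrM ler_nat; apply: leq_trans (count_hits W2).
  by apply: sub_count => e /andP[].
have n12le : n12%:R <= t1 * t2 by rewrite -natrM ler_nat; apply: count_hits2.
have n1n2 : rho * (n1 + n2)%:R <= 1.
  apply: le_trans rho_small; rewrite ler_wpM2l // ler_nat.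
  rewrite -count_predUI -[leqRHS]addn0; apply: leq_add; first exact: count_size.
  rewrite leqn0 eqn0Ngt -has_count; apply/hasPn => e _ /=.
  by case: (hits W1 e); case: (hits W2 e).
have sumT : `|\sum_(e <- s) (T e + (hits W1 e (+) hits W2 e)%:R * cov j F1 F2)| <=
    n1%:R * (b * ((t1 + r%:R) * t2)) + n2%:R * (b * (t1 * (t2 + r%:R))) + n12%:R * 3.
  apply: le_trans (ler_norm_sum _ _ _) _.
  rewrite -!sum_count !mulr_suml -!big_split /= big_seq [leRHS]big_seq.
  by apply: ler_sum => e es; apply: Te.
rewrite big_split /= -mulr_suml sum_count in sumT.
have xorE : count (fun e => hits W1 e (+) hits W2 e) s = (n1 + n2)%N.
  rewrite -count_predUI [X in (_ + X)%N](_ : _ = 0%N).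
    by rewrite addn0; apply: eq_count => e /=; case: (hits W1 e); case: (hits W2 e).
  apply/eqP; rewrite eqn0Ngt -has_count; apply/hasPn => e _ /=.
  by case: (hits W1 e); case: (hits W2 e).
rewrite xorE in sumT.
have hAB : `|(rho * \sum_(e <- s) A e) * (rho * \sum_(e <- s) B e)| <= h ^+ 2 * (t1 * t2).
  rewrite !normrM (ger0_norm rho_ge0).
  have -> : h ^+ 2 * (t1 * t2) = (rho * (D%:R * t1)) * (rho * (D%:R * t2)).
    by rewrite /h; ring.
  by apply: ler_pM; rewrite ?mulr_ge0 // ler_wpM2l.
have step1 : `|cov j F1 F2 + rho * \sum_(e <- s) T e| <=
    (1 - rho * (n1 + n2)%:R) * (b * (t1 * t2)) +
    rho * (n1%:R * (b * ((t1 + r%:R) * t2)) + n2%:R * (b * (t1 * (t2 + r%:R))) + n12%:R * 3).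
  have -> : cov j F1 F2 + rho * \sum_(e <- s) T e =
     (1 - rho * (n1 + n2)%:R) * cov j F1 F2 +
     rho * (\sum_(e <- s) T e + (n1 + n2)%:R * cov j F1 F2) by ring.
  apply: le_trans (ler_normD _ _) _; rewrite !normrM (ger0_norm rho_ge0).
  rewrite ger0_norm ?subr_ge0 //.
  by apply: lerD; apply: ler_wpM2l; rewrite ?subr_ge0.
rewrite covE; apply: le_trans (ler_normB _ _) _.
apply: le_trans (lerD step1 hAB) _.
have k1 : rho * (b * r%:R * t2) * n1%:R <= rho * (b * r%:R * t2) * (D%:R * t1).
  by apply: ler_wpM2l => //; rewrite mulr_ge0 // mulr_ge0 // mulr_ge0.
have k2 : rho * (b * r%:R * t1) * n2%:R <= rho * (b * r%:R * t1) * (D%:R * t2).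
  by apply: ler_wpM2l => //; rewrite mulr_ge0 // mulr_ge0 // mulr_ge0.
have k3 : rho * 3 * n12%:R <= rho * 3 * (t1 * t2).
  by apply: ler_wpM2l => //; rewrite mulr_ge0.
apply: (@le_trans _ _ (((1 + 2 * h * r%:R) * b + (3 * rho + h ^+ 2)) * (t1 * t2))); last first.
  by apply: ler_wpM2r; [rewrite mulr_ge0 | apply: beta_step].
have -> : ((1 + 2 * h * r%:R) * b + (3 * rho + h ^+ 2)) * (t1 * t2) =
   b * (t1 * t2) + rho * (b * r%:R * t2) * (D%:R * t1) + rho * (b * r%:R * t1) * (D%:R * t2)
   + rho * 3 * (t1 * t2) + h ^+ 2 * (t1 * t2) by rewrite /h; ring.
rewrite natrD; lra.
Qed.

End LinearRegular.

(** * The uncovered fraction *)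

Lemma bernoulli_ge (R : realDomainType) (a : R) m : 0 <= a -> 1 + m%:R * a <= (1 + a) ^+ m.
Proof.
move=> a0; elim: m => [|m IH]; first by rewrite mul0r addr0 expr0.
rewrite exprS; have b0 : 0 <= 1 + a by rewrite addr_ge0.
apply: le_trans (ler_wpM2l b0 IH); rewrite -natr1 -subr_ge0.
have -> : (1 + a) * (1 + m%:R * a) - (1 + (m%:R + 1) * a) = m%:R * a ^+ 2 by ring.
by rewrite mulr_ge0 ?sqr_ge0.
Qed.

Section GreedyDensity.
Variables (R : realType) (V E : finType) (s : seq E) (del : E -> {set V}).
Variables (X : {set V}) (r D : nat).
Hypothesis lr : linear_regular s del X r D.
Variable rho : R.
Hypothesis rho_ge0 : 0 <= rho.
Hypothesis rho_small : rho * (size s)%:R <= 1.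

Local Notation mean := (mu s del rho).
Local Notation beta := (beta r D rho).
Let h := rho * D%:R.

Definition uncovered j v : R := mean j (fun C => (v \notin C)%:R).
Definition available j e : R := mean j (fun C => [disjoint del e & C]%:R).

Lemma unit_bool (b : bool) : 0 <= (b%:R : R) <= 1.
Proof. by case: b; rewrite /= ?ler01 ?lexx. Qed.

Lemma uncovered_unit j v : 0 <= uncovered j v <= 1.
Proof. by apply: mu_unit => // C; apply: unit_bool. Qed.

(** Each vertex split off from the list costs one covariance. *)
Lemma mu_uncovered_seq j t : uniq t ->
  `|mean j (fun C => (all [predC C] t)%:R) - \prod_(v <- t) uncovered j v|
    <= beta j * (size t)%:R ^+ 2.
Proof.
have b0 : 0 <= beta j by apply: beta_ge0.
elim: t => [|v t IH]; first by rewrite big_nil mu_cst subrr normr0 mulr_ge0 ?sqr_ge0.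
move=> /= /andP[vt ut]; rewrite big_cons; have := IH ut.
have dv : depends_on [set v] (fun C : {set V} => (v \notin C)%:R : R).
  by move=> C; rewrite !inE eqxx andbT.
have dt : depends_on [set:: t] (fun C : {set V} => (all [predC C] t)%:R : R).
  move=> C; congr (_%:R); apply/f_equal; apply: eq_in_all => w wt.
  by rewrite !inE wt andbT.
have dj : [disjoint [set v] & [set:: t]] by rewrite disjoints1 inE.
have := cov_le lr rho_ge0 rho_small j dj dv dt (fun=> unit_bool _) (fun=> unit_bool _).
rewrite cards1 mul1r cardsE (card_uniqP ut) /cov.
have -> : (fun C : {set V} => (v \notin C)%:R * (all [predC C] t)%:R) =
  (fun C => (all [predC C] (v :: t))%:R : R).
  by apply/funext => C; rewrite -natrM mulnb.
rewrite -/(uncovered j v) /=; set y := mean _ _; set z := mean _ _; set P := \prod_(_ <- _) _.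
have /andP[x0 x1] := uncovered_unit j v; set x := uncovered j v in x0 x1 *.
move=> h1 h2.
have -> : y - x * P = (y - x * z) + x * (z - P) by ring.
apply: le_trans (ler_normD _ _) _; rewrite normrM (ger0_norm x0).
apply: le_trans (lerD h1 (ler_piMl (normr_ge0 _) x1)) _.
apply: le_trans (lerD (lexx _) h2) _.
rewrite -mulrDr ler_wpM2l // -natr1.
have : 0 <= (size t)%:R :> R by [].
nra.
Qed.

Lemma available_prod j e : e \in s ->
  `|available j e - \prod_(v in del e) uncovered j v| <= beta j * r%:R ^+ 2.
Proof.
move=> es; have := mu_uncovered_seq j (enum_uniq (del e)).
rewrite -cardE (lr_card lr es) big_enum /= /available.
have -> // : (fun C : {set V} => (all [predC C] (enum (del e)))%:R) =
  (fun C : {set V} => [disjoint del e & C]%:R : R).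
apply/funext => C; congr (_%:R); apply/f_equal; apply/allP/idP => [eC|dC v].
  rewrite finset.disjoints_subset; apply/fintype.subsetP => v ve; rewrite inE.
  by apply: eC; rewrite mem_enum.
by rewrite mem_enum => ve /=; rewrite (disjointFr dC ve).
Qed.

Lemma uncovered_step j v :
  uncovered j.+1 v = uncovered j v - rho * \sum_(e <- s) (v \in del e)%:R * available j e.
Proof.
rewrite /uncovered mu_recE; congr (_ + _); rewrite -mulrN; congr (_ * _).
rewrite -sumrN; apply: eq_bigr => e _; rewrite -muB /available -mulNr -muZ.
congr mu; apply/funext => C; rewrite /cover_edge; case: ifP => dC.
  rewrite inE negb_or; have [ve|ve] /= := boolP (v \in del e).
    by rewrite (disjointFr dC ve) /= sub0r mulr1.
  by rewrite subrr oppr0 mul0r.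
by rewrite subrr mulr0.
Qed.

(** Euler's scheme for [u' = - u ^ r], which governs the uncovered fraction. *)
Fixpoint euler (j : nat) : R := if j is j'.+1 then euler j' - h * euler j' ^+ r else 1.

Hypothesis r_gt0 : (0 < r)%N.
Hypothesis h_le1 : h <= 1.

Lemma euler_unit j : 0 <= euler j <= 1.
Proof.
have h0 : 0 <= h by rewrite mulr_ge0.
elim: j => [|j /andP[u0 u1]] /=; first by rewrite ler01 lexx.
have p0 : 0 <= euler j ^+ r by rewrite exprn_ge0.
have pu : euler j ^+ r <= euler j by rewrite -[leRHS]expr1; apply: ler_wiXn2l.
have := ler_piMl p0 h_le1; have := mulr_ge0 h0 p0.
by move=> ? ?; apply/andP; split; lra.
Qed.

(** [euler ^ -(r - 1)] grows at least linearly, by Bernoulli's inequality; stated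
    without division. *)
Lemma euler_decay j : euler j ^+ r.-1 * (1 + r.-1%:R * (j%:R * h)) <= 1.
Proof.
have h0 : 0 <= h by rewrite mulr_ge0.
set m := r.-1; elim: j => [|j IH].
  by rewrite /= mul0r mulr0 addr0 mulr1 expr1n.
have /andP[u0 u1] := euler_unit j; rewrite /=; set u := euler j in u0 u1 IH *.
have um0 : 0 <= u ^+ m by rewrite exprn_ge0.
have um1 : u ^+ m <= 1 by rewrite exprn_ile1.
set a := h * u ^+ m; have a0 : 0 <= a by rewrite mulr_ge0.
have a1 : a <= 1 by rewrite mulr_ile1.
have -> : u - h * u ^+ r = u * (1 - a).
  by rewrite /a -(prednK r_gt0) exprS -/m; ring.
rewrite exprMn; set w := (1 - a) ^+ m.
have w0 : 0 <= w by rewrite exprn_ge0 // subr_ge0.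
have wa : w * (1 + m%:R * a) <= 1.
  apply: (@le_trans _ _ (w * (1 + a) ^+ m)).
    by rewrite ler_wpM2l // bernoulli_ge.
  rewrite -exprMn; apply: exprn_ile1; rewrite -subr_sqr expr1n.
    by rewrite subr_ge0 exprn_ile1.
  by rewrite gerBl sqr_ge0.
apply: le_trans wa; rewrite [leLHS](_ : _ = w * (u ^+ m * (1 + m%:R * (j%:R * h)) + m%:R * a)).
  by rewrite ler_wpM2l // lerD2r.
by rewrite -natr1 /a; ring.
Qed.

Lemma prod_dist (t : seq V) (x : V -> R) (u d : R) : 0 <= d -> 0 <= u <= 1 ->
  (forall v, v \in t -> 0 <= x v <= 1 /\ `|x v - u| <= d) ->
  `|\prod_(v <- t) x v - u ^+ size t| <= (size t)%:R * d.
Proof.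
move=> d0 /andP[u0 u1]; elim: t => [|v t IH] xt.
  by rewrite big_nil expr0 subrr normr0 mul0r.
have := IH (fun w wt => xt w (@mem_behead _ (v :: t) _ wt)).
have [/andP[x0 x1] dx] := xt v (mem_head _ _).
rewrite big_cons exprS /=; set P := \prod_(_ <- _) _; set U := u ^+ _ => hP.
have U0 : 0 <= U by rewrite exprn_ge0.
have U1 : U <= 1 by rewrite exprn_ile1.
have -> : x v * P - u * U = x v * (P - U) + (x v - u) * U by ring.
apply: le_trans (ler_normD _ _) _; rewrite !normrM (ger0_norm x0) (ger0_norm U0).
have a1 := ler_piMl (normr_ge0 (P - U)) x1.
have a2 := ler_piMr (normr_ge0 (x v - u)) U1.
by rewrite -natr1; lra.
Qed.

(** Replacing [available] by a product of [uncovered] closes the one-step equation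
    of the latter, up to [beta]; as products of [r] numbers in [[0, 1]] are
    [r]-Lipschitz, the distance to Euler's scheme grows by a factor
    [1 + h r] and by this error in each step. *)
Lemma uncovered_euler k j v : (j <= k)%N -> v \in X ->
  `|uncovered j v - euler j| <=
     (1 + h * r%:R) ^+ j * (j%:R * (h * (beta k * r%:R ^+ 2))).
Proof.
have h0 : 0 <= h by rewrite mulr_ge0.
have g1 : 1 <= 1 + h * r%:R by rewrite lerDl mulr_ge0.
have b0 : 0 <= beta k by apply: beta_ge0.
set w := h * (beta k * _).
have w0 : 0 <= w by rewrite mulr_ge0 // mulr_ge0 ?sqr_ge0.
elim: j v => [|j IH] v jk vX.
  by rewrite /uncovered /euler /mu /= inE /= subrr normr0 mul0r mulr0.
have {}IH := IH _ (ltnW jk).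
set d := (1 + h * r%:R) ^+ j * (j%:R * w) in IH.
have d0 : 0 <= d.
  by apply: mulr_ge0; [apply: exprn_ge0; apply: le_trans g1 | apply: mulr_ge0].
have ye e : e \in s -> `|available j e - euler j ^+ r| <= r%:R * d + beta k * r%:R ^+ 2.
  move=> es.
  rewrite (_ : _ - _ = (\prod_(v in del e) uncovered j v - euler j ^+ r) +
     (available j e - \prod_(v in del e) uncovered j v)); last by ring.
  apply: le_trans (ler_normD _ _) _; apply: lerD.
    rewrite -(lr_card lr es) cardE -big_enum; apply: prod_dist => //.
      exact: euler_unit.
    move=> x; rewrite mem_enum => xe; split; first exact: uncovered_unit.
    by apply: IH; apply: (fintype.subsetP (lr_sub lr es)).
  apply: le_trans (available_prod j es) _; apply: ler_wpM2r; first exact: sqr_ge0.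
  by apply: le_beta => //; apply: ltnW.
have Du : h * euler j ^+ r = rho * \sum_(e <- s) (v \in del e)%:R * euler j ^+ r.
  by rewrite -mulr_suml sum_count (lr_degree lr vX) mulrA.
rewrite uncovered_step /= Du.
rewrite (_ : _ - _ = (uncovered j v - euler j) -
   rho * \sum_(e <- s) (v \in del e)%:R * (available j e - euler j ^+ r)); last first.
  by under [X in _ = _ - _ * X]eq_bigr do rewrite mulrBr; rewrite sumrB; ring.
apply: le_trans (ler_normB _ _) _; rewrite normrM (ger0_norm rho_ge0).
have S1 : `|\sum_(e <- s) (v \in del e)%:R * (available j e - euler j ^+ r)| <=
   D%:R * (r%:R * d + beta k * r%:R ^+ 2).
  apply: le_trans (ler_norm_sum _ _ _) _.
  have -> : D%:R = \sum_(e <- s) (v \in del e)%:R :> R.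
    by rewrite sum_count (lr_degree lr vX).
  rewrite mulr_suml big_seq [leRHS]big_seq.
  apply: ler_sum => e es; rewrite normrM ger0_norm //.
  by apply: ler_wpM2l => //; apply: ye.
have := ler_wpM2l rho_ge0 S1; have := IH v vX.
set A := `|_|; set B := rho * `|_| => hA hB.
apply: (@le_trans _ _ ((1 + h * r%:R) * d + w)).
  apply: le_trans (lerD hA hB) _; rewrite /w /h; lra.
have -> : (1 + h * r%:R) ^+ j.+1 * (j.+1%:R * w) =
   (1 + h * r%:R) * d + (1 + h * r%:R) ^+ j.+1 * w.
  by rewrite /d -natr1 exprS; ring.
by rewrite lerD2l -[leLHS]mul1r ler_wpM2r // exprn_ege1.
Qed.

(** The number of edges of a matching, read off the set of vertices it covers. *)
Definition edge_count (C : {set V}) : R := (\sum_(v in X) (v \in C)%:R) / r%:R.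

Lemma mu_edge_count k :
  (#|X|%:R / r%:R) * (1 - euler k - (1 + h * r%:R) ^+ k * (k%:R * (h * (beta k * r%:R ^+ 2))))
   <= mean k edge_count.
Proof.
have -> : edge_count = (fun C => r%:R^-1 * \sum_(v in X) (1 - (v \notin C)%:R)).
  apply/funext => C; rewrite /edge_count mulrC; congr (_ * _); apply: eq_bigr => v _.
  by case: (v \in C); rewrite /= ?subr0 ?subrr.
rewrite muZ mu_sum mulrAC [leLHS]mulrC ler_wpM2l ?invr_ge0 //.
rewrite -sum1_card natr_sum mulr_suml; apply: ler_sum => v vX.
rewrite mul1r muB mu_cst -/(uncovered k v).
have := uncovered_euler (leqnn k) vX; rewrite ler_norml => /andP[_]; lra.
Qed.

End GreedyDensity.

(** * Expected matching number *)

Section MatchingNumber.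
Variables (V E : finType) (del : E -> {set V}).
Implicit Types (G K : {set E}).

Definition matching K :=
  [forall e in K, forall f in K, (e != f) ==> [disjoint del e & del f]].

Definition matchnum G := \max_(K : {set E} | (K \subset G) && matching K) #|K|.

Definition covered K : {set V} := \bigcup_(e in K) del e.

Lemma matchingP K :
  reflect {in K &, forall e f, e != f -> [disjoint del e & del f]} (matching K).
Proof.
apply: (iffP forall_inP) => mK e.
  by move=> f eK fK ef; have /forall_inP/(_ f fK)/implyP := mK e eK; apply.
by move=> eK; apply/forall_inP => f fK; apply/implyP; apply: mK.
Qed.

Lemma matching_sub K K' : K \subset K' -> matching K' -> matching K.
Proof.
move=> /fintype.subsetP KK' /matchingP mK'; apply/matchingP => e f eK fK.
by apply: mK'; apply: KK'.
Qed.

Lemma matchnum_ge K G : K \subset G -> matching K -> (#|K| <= matchnum G)%N.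
Proof. by move=> KG mK; rewrite /matchnum (bigop.bigmax_sup K) ?KG. Qed.

Lemma matchnum_witness G : exists K, [/\ K \subset G, matching K & #|K| = matchnum G].
Proof.
have ex : (0 < #|[pred K : {set E} | (K \subset G) && matching K]|)%N.
  apply/card_gt0P; exists finset.set0; rewrite inE finset.sub0set /=.
  by apply/matchingP => e f; rewrite inE.
by have [K /andP[KG mK] eK] := eq_bigmax_cond (fun K : {set E} => #|K|) ex; exists K.
Qed.

Lemma matchnum_mono G G' : G \subset G' -> (matchnum G <= matchnum G')%N.
Proof.
move=> GG'; have [K [KG mK <-]] := matchnum_witness G.
by apply: matchnum_ge mK; apply: fintype.subset_trans GG'.
Qed.

Lemma matchnum_setU1 e G : (matchnum (e |: G) <= (matchnum G).+1)%N.
Proof.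
have [K [KG mK <-]] := matchnum_witness (e |: G).
rewrite (cardsD1 e K) -add1n; apply: leq_add; first exact: leq_b1.
apply: matchnum_ge; last exact: matching_sub (finset.subsetDl _ _) mK.
by rewrite finset.subDset.
Qed.

Lemma matching_setU1 e K : matching K -> [disjoint del e & covered K] -> matching (e |: K).
Proof.
move=> /matchingP mK de.
have ek f : f \in K -> [disjoint del e & del f].
  by move=> fK; apply: disjointWr de; apply: finset.bigcup_sup.
apply/matchingP => x y /setU1P[->|xK] /setU1P[->|yK] xy; rewrite ?eqxx // in xy *.
- exact: ek.
- by rewrite disjoint_sym; apply: ek.
- exact: mK.
Qed.

Lemma covered_setU1 e K : covered (e |: K) = del e :|: covered K.
Proof. by rewrite /covered finset.bigcup_setU big_set1. Qed.

End MatchingNumber.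

Section ExpectedMatching.
Variables (R : realType) (V E : finType) (s : seq E) (del : E -> {set V}).
Variables (X : {set V}) (r D : nat).
Hypothesis lr : linear_regular s del X r D.
Hypothesis r_gt0 : (0 < r)%N.

Local Notation ν G := ((matchnum del G)%:R : R).

Lemma matchnum_monotone (K : {set E}) : subset_monotone (fun G => ν (K :|: G)).
Proof. by move=> G G' GG'; rewrite ler_nat matchnum_mono // finset.setUS. Qed.

Lemma edge_count_covered (K : {set E}) : {subset K <= s} ->
  edge_count R X r (covered del K) <= #|K|%:R.
Proof.
move=> Ks; rewrite /edge_count ler_pdivrMr ?ltr0n //.
apply: (@le_trans _ _ (\sum_(v in X) \sum_(e in K) (v \in del e)%:R)).
  apply: ler_sum => v _; have [/finset.bigcupP[e eK ve]|//] := boolP (v \in covered del K).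
    by rewrite (bigD1 e) //= ve lerDl sumr_ge0.
  by rewrite sumr_ge0.
rewrite exchange_big /= -natrM -sum_nat_const natr_sum; apply: ler_sum => e eK.
rewrite -(lr_card lr (Ks e eK)) -sum1_card natr_sum big_mkcond [leRHS]big_mkcond.
by apply: ler_sum => v _; case: (v \in X); case: (v \in del e).
Qed.

(** Exposing the random hypergraph in [j] independent layers of density [q], the
    layers that consist of one edge drive the lazy process. *)
Lemma process_le_matchnum (q : R) j (K : {set E}) : 0 <= q <= 1 ->
  q * (1 - q) ^+ size s * (size s)%:R <= 1 ->
  matching del K -> {subset K <= s} ->
  iter j (step s del (q * (1 - q) ^+ size s)) (edge_count R X r) (covered del K)
    <= Ex (1 - (1 - q) ^+ j) s (fun G => ν (K :|: G)).
Proof.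
move=> q01 small; have /andP[q0 q1] := q01.
set rho := q * _ in small *.
have rho0 : 0 <= rho by rewrite mulr_ge0 // exprn_ge0 // subr_ge0.
elim: j K => [|j IH] K mK Ks.
  rewrite expr0 subrr Ex0 /= finset.setU0; apply: le_trans (edge_count_covered Ks) _.
  by rewrite ler_nat matchnum_ge.
have pj01 : 0 <= 1 - (1 - q) ^+ j <= 1.
  rewrite subr_ge0 exprn_ile1 ?subr_ge0 ?gerBl //=.
  by rewrite exprn_ge0 // subr_ge0.
set pj := 1 - (1 - q) ^+ j in IH pj01.
have -> : 1 - (1 - q) ^+ j.+1 = 1 - (1 - q) * (1 - pj) by rewrite /pj exprS; ring.
rewrite Ex_union; pose H G1 := Ex pj s (fun G => ν (K :|: (G1 :|: G))).
have mH : subset_monotone H.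
  move=> G1 G2 G12; apply: le_Ex => // G _; apply: matchnum_monotone.
  exact: finset.setSU.
apply: le_trans (Ex_ge_single s q01 mH).
rewrite iterS step_convex //.
have -> : H finset.set0 + q * (1 - q) ^+ size s * \sum_(e <- s) (H [set e] - H finset.set0) =
  (1 - rho * (size s)%:R) * H finset.set0 + rho * \sum_(e <- s) H [set e].
  rewrite sumrB big_const_seq count_predT iter_addr_0 -[H _ *+ _]mulr_natr /rho.
  by ring.
have H0 : iter j (step s del rho) (edge_count R X r) (covered del K) <= H finset.set0.
  apply: le_trans (IH K mK Ks) _; apply: le_Ex => // G _.
  by rewrite finset.set0U.
apply: lerD; first by apply: ler_wpM2l; rewrite ?subr_ge0.
apply: ler_wpM2l => //; rewrite big_seq [leRHS]big_seq; apply: ler_sum => e es.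
rewrite /cover_edge; case: ifP => de; last first.
  by apply: le_trans H0 _; apply: mH; apply: finset.sub0set.
rewrite -covered_setU1; apply: le_trans (IH _ _ _) _.
- exact: matching_setU1.
- by move=> x /setU1P[->|/Ks].
apply: le_Ex => // G _; rewrite ler_nat; apply: matchnum_mono.
by rewrite finset.setUA [K :|: _]finset.setUC.
Qed.

Lemma one_sub_natmul_le (q : R) n : 0 <= q <= 1 -> 1 - n%:R * q <= (1 - q) ^+ n.
Proof.
move=> /andP[q0 q1]; elim: n => [|n IH]; first by rewrite mul0r subr0 expr0.
have b0 : 0 <= 1 - q by rewrite subr_ge0.
rewrite exprS; apply: le_trans (ler_wpM2l b0 IH); rewrite -natr1 -subr_ge0.
have -> : (1 - q) * (1 - n%:R * q) - (1 - (n%:R + 1) * q) = n%:R * q ^+ 2 by ring.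
by rewrite mulr_ge0 ?sqr_ge0.
Qed.

Lemma growth_le_expR (x y : R) n : 0 <= x -> n%:R * x <= y -> (1 + x) ^+ n <= expR y.
Proof.
move=> x0 xy; apply: (@le_trans _ _ (expR x ^+ n)).
  by apply: lerXn2r; rewrite ?nnegrE ?expR_ge0 ?addr_ge0 ?expR_ge1Dx.
by rewrite -expRM_natl ler_expR.
Qed.

Lemma handshake : (size s * r = #|X| * D)%N.
Proof.
have -> : (size s * r = \sum_(e <- s) #|del e|)%N.
  rewrite big_seq (eq_bigr (fun=> r)) => [|e es]; last by rewrite (lr_card lr es).
  by rewrite -big_seq big_const_seq count_predT iter_addn_0 mulnC.
rewrite -sum_nat_const.
under eq_bigr => e _ do rewrite -sum1_card.
rewrite big_seq (eq_bigr (fun e => \sum_(v in X) (v \in del e))%N); last first.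
  move=> e es; rewrite big_mkcond [RHS]big_mkcond; apply: eq_bigr => v _.
  case: (boolP (v \in del e)) => [ve|]; last by case: ifP.
  by rewrite (fintype.subsetP (lr_sub lr es) v ve).
rewrite -big_seq exchange_big /=; apply: eq_bigr => v vX.
by rewrite -(lr_degree lr vX) -sum1_count [RHS]big_mkcond.
Qed.

(** The limit of the greedy process, with explicit error. Exposing the density [p]
    in [N D] layers, [N] the number of edges, makes the probability of two edges in
    one layer and the terms quadratic in the step as small as the covariances. The
    error is quadratic in [p D], so it is negligible against [1 - u] even when
    [p D] is small. *)
Lemma Ex_matchnum_ge (c1 p : R) : (0 < D)%N -> (r <= #|X|)%N ->
  0 <= p <= 1 -> p * D%:R <= c1 ->
  exists2 u : R, 0 <= u <= 1 /\
      u ^+ r.-1 * (1 + r.-1%:R * (p * D%:R * (1 - D%:R^-1))) <= 1 &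
    (#|X|%:R / r%:R) * (1 - u - 4 * r%:R ^+ 2 * expR (3 * r%:R * c1) * (p * D%:R) ^+ 2 / D%:R)
      <= Ex p s (fun G => ν G).
Proof.
move=> D_gt0 rX p01 pD; have /andP[p0 p1] := p01.
set c := p * D%:R in pD *.
set N := size s.
have DN : (D <= N)%N.
  by rewrite -(leq_pmul2r r_gt0) handshake mulnC leq_pmul2r.
have N_gt0 : (0 < N)%N by apply: leq_trans DN.
pose k := (N * D)%N.
have k_gt0 : (0 < k)%N by rewrite muln_gt0 N_gt0.
pose q : R := p / k%:R.
have kq : k%:R * q = p by rewrite /q mulrC divfK // pnatr_eq0 -lt0n.
have k1 : 1 <= k%:R :> R by rewrite ler1n.
have q0 : 0 <= q by rewrite divr_ge0.
have q1 : q <= 1 by rewrite ler_pdivrMr ?ltr0n // mul1r (le_trans p1).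
have q01 : 0 <= q <= 1 by rewrite q0.
have dD0 : 0 < D%:R :> R by rewrite ltr0n.
have dN0 : 0 < N%:R :> R by rewrite ltr0n.
have Nq : N%:R * q <= D%:R^-1.
  rewrite -[leRHS]mul1r ler_pdivlMr //.
  by have -> : N%:R * q * D%:R = p by rewrite -kq /k natrM; ring.
have w0 : 0 <= (1 - q) ^+ N by rewrite exprn_ge0 // subr_ge0.
have w1 : (1 - q) ^+ N <= 1 by rewrite exprn_ile1 ?subr_ge0 // gerBl.
pose rho : R := q * (1 - q) ^+ N.
have rho0 : 0 <= rho by rewrite mulr_ge0.
have rhoq : rho <= q by rewrite ler_piMr.
have Di1 : D%:R^-1 <= 1 :> R by rewrite invf_le1 // ler1n.
have small : rho * N%:R <= 1.
  rewrite mulrC; apply: le_trans Di1; apply: le_trans Nq.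
  by rewrite ler_wpM2l.
pose h := rho * D%:R.
have h0 : 0 <= h by rewrite mulr_ge0.
have hD : h <= D%:R^-1.
  have hN : N%:R * h <= 1.
    apply: le_trans p1; rewrite -kq /k natrM /h.
    have -> : N%:R * (rho * D%:R) = N%:R * D%:R * rho by ring.
    by rewrite ler_wpM2l // mulr_ge0.
  rewrite -[leRHS]mul1r ler_pdivlMr //; apply: le_trans hN; rewrite mulrC.
  by rewrite ler_wpM2r // ler_nat.
have h1 : h <= 1 by apply: le_trans Di1.
have kh : k%:R * h = c * (1 - q) ^+ N by rewrite /h /rho /c -kq; ring.
have c0 : 0 <= c by rewrite mulr_ge0.
have khc : k%:R * h <= c by rewrite kh ler_piMr.
have khc1 : k%:R * h <= c1 by apply: le_trans pD.
have khge : c * (1 - D%:R^-1) <= k%:R * h.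
  rewrite kh ler_wpM2l //; apply: le_trans (one_sub_natmul_le N q01).
  by rewrite lerD2l lerN2.
exists (euler r D rho k).
  split; first exact: euler_unit.
  apply: le_trans (euler_decay rho0 r_gt0 h1 k); apply: ler_wpM2l.
    by apply: exprn_ge0; case/andP: (euler_unit rho0 r_gt0 h1 k).
  by rewrite lerD2l ler_wpM2l.
have pk1 : (1 - q) ^+ k <= 1 by rewrite exprn_ile1 ?subr_ge0 // gerBl.
have pk0 : 0 <= (1 - q) ^+ k by rewrite exprn_ge0 // subr_ge0.
apply: (@le_trans _ _ (Ex (1 - (1 - q) ^+ k) s (fun G => ν G))); last first.
  apply: Ex_mono_p => //; first by rewrite subr_ge0.
    by have := one_sub_natmul_le k q01; rewrite kq; lra.
  by move=> G G' GG'; rewrite ler_nat matchnum_mono.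
have m0 : matching del finset.set0 by apply/matchingP => e f; rewrite inE.
have s0 : {subset (finset.set0 : {set E}) <= s} by move=> e; rewrite inE.
have := process_le_matchnum k q01 small m0 s0.
rewrite -/rho /covered big_set0.
rewrite (eq_Ex _ _ (F2 := fun G => ν G)) => [|G]; last by rewrite finset.set0U.
apply: le_trans.
apply: le_trans (mu_edge_count lr rho0 small r_gt0 h1 k).
apply: ler_wpM2l; first by rewrite divr_ge0.
rewrite lerD2l lerN2 -/h.
have g1 : (1 + h * r%:R) ^+ k <= expR (r%:R * c1).
  apply: growth_le_expR; first by rewrite mulr_ge0.
  by rewrite mulrA [leRHS]mulrC ler_wpM2r.
have g2 : (1 + 2 * h * r%:R) ^+ k <= expR (2 * r%:R * c1).
  apply: growth_le_expR; first by rewrite mulr_ge0 // mulr_ge0.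
  have -> : k%:R * (2 * h * r%:R) = 2 * r%:R * (k%:R * h) by ring.
  by rewrite ler_wpM2l // mulr_ge0.
have bk : beta r D rho k <= expR (2 * r%:R * c1) * (4 * (c / D%:R)).
  rewrite /beta -/h; apply: ler_pM => //.
  - by rewrite exprn_ge0 // addr_ge0 // mulr_ge0 // mulr_ge0.
  - by rewrite mulr_ge0 // addr_ge0 ?sqr_ge0 // mulr_ge0.
  (* [k * rho * D = k * h] is the elapsed time, at most [c], and [h <= 1 / D] *)
  have -> : k%:R * (3 * rho + h ^+ 2) = 3 * (k%:R * h / D%:R) + (k%:R * h) * h.
    by rewrite /h; field; rewrite gt_eqF.
  have a1 : k%:R * h / D%:R <= c / D%:R by rewrite ler_wpM2r // invr_ge0.
  have a2 : k%:R * h * h <= c / D%:R by rewrite ler_pM // mulr_ge0.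
  by lra.
have b0 : 0 <= beta r D rho k by apply: beta_ge0.
have -> : 4 * r%:R ^+ 2 * expR (3 * r%:R * c1) * c ^+ 2 / D%:R =
  expR (r%:R * c1) * (c * (expR (2 * r%:R * c1) * (4 * (c / D%:R)) * r%:R ^+ 2)).
  have -> : 3 * r%:R * c1 = r%:R * c1 + 2 * r%:R * c1 by ring.
  by rewrite expRD; field; rewrite gt_eqF.
apply: ler_pM => //.
- by rewrite exprn_ge0 // addr_ge0 // mulr_ge0.
- by apply: mulr_ge0 => //; apply: mulr_ge0 => //; apply: mulr_ge0 => //; apply: sqr_ge0.
rewrite mulrA; apply: ler_pM => //.
- by rewrite mulr_ge0.
- by apply: mulr_ge0 => //; apply: sqr_ge0.
- by rewrite ler_wpM2r // sqr_ge0.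
Qed.

End ExpectedMatching.

(** * Covers *)

Section Covers.
Variables (R : realType) (V E : finType) (s : seq E) (del : E -> {set V}).
Variables (X : {set V}) (r D : nat).
Hypothesis lr : linear_regular s del X r D.

Lemma Ex_witness (T : finType) (p : R) (t : seq T) (F : {set T} -> R) : 0 <= p <= 1 ->
  exists2 G : {set T}, {subset G <= t} & F G <= Ex p t F.
Proof.
move=> p01; have /andP[p0 p1] := p01; elim: t F => [|x t IH] F /=.
  by exists finset.set0 => // y; rewrite inE.
have [G1 G1t F1] := IH (fun G => F (x |: G)); have [G0 G0t F0] := IH F.
have [le01|le10] := leP (F (x |: G1)) (F G0).
  exists (x |: G1); first by move=> y /setU1P[->|/G1t yt]; rewrite in_cons ?eqxx ?yt ?orbT.
  nra.
exists G0; first by move=> y /G0t yt; rewrite in_cons yt orbT.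
nra.
Qed.

Lemma Ex_disjoint (T : finType) (p : R) (t : seq T) (A : {set T}) :
  Ex p t (fun G => [disjoint A & G]%:R) = (1 - p) ^+ count [in A] t.
Proof.
elim: t => [|x t IH] /=.
  by rewrite expr0 finset.disjoints_subset finset.setC0 finset.subsetT.
rewrite IH; have [xA|xA] /= := boolP (x \in A).
  rewrite (@eq_Ex _ _ _ _ _ (fun=> 0)) ?Ex_cst ?mulr0 ?add0r ?exprS // => G.
  by rewrite (_ : [disjoint _ & _] = false) //; apply/negP => /disjointFr/(_ xA); rewrite setU11.
rewrite (@eq_Ex _ _ _ _ _ (fun G => [disjoint A & G]%:R)) ?IH; last first.
  move=> G; congr (_%:R); apply/f_equal.
  by rewrite !(disjoint_sym A) !finset.disjoints_subset finset.subUset finset.sub1set inE xA.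
by rewrite add0n; ring.
Qed.

(** The size of the cover made of [S] and of one vertex from each edge of [G] that
    [S] misses. *)
Definition cover_cost (S : {set V}) (G : {set E}) : nat :=
  (#|S| + #|[set e in G | [disjoint del e & S]]|)%N.

Lemma Ex_cover_cost (p : R) S : Ex p s (fun G => (cover_cost S G)%:R) =
  #|S|%:R + p * (count (fun e => [disjoint del e & S]) s)%:R.
Proof.
rewrite -Ex_card ?(lr_uniq lr) // -[#|S|%:R](Ex_cst p s) -ExD.
by apply: eq_Ex => G; rewrite natrD.
Qed.

(** Put each vertex in [S] with probability [q]: an edge is missed with probability
    [(1 - q) ^ r]. *)
Lemma random_cover (p q : R) : 0 <= q <= 1 -> exists2 S : {set V}, S \subset X &
  #|S|%:R + p * (count (fun e => [disjoint del e & S]) s)%:R <=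
    #|X|%:R * q + p * (size s)%:R * (1 - q) ^+ r.
Proof.
move=> q01.
have [S SX hS] := Ex_witness (enum X) (fun S : {set V} => #|S|%:R +
  p * (count (fun e => [disjoint del e & S]) s)%:R) q01.
exists S; first by apply/fintype.subsetP => v /SX; rewrite mem_enum.
apply: le_trans hS _; rewrite ExD ExZ.
have -> : Ex q (enum X) (fun S => #|S|%:R) = #|X|%:R * q.
  rewrite (@eq_Ex _ _ _ _ _ (fun S => #|[set v in S | predT v]|%:R)) => [|S0].
    by rewrite Ex_card ?enum_uniq // count_predT -cardE mulrC.
  by congr (_%:R); apply: eq_card => v; rewrite inE andbT.
rewrite lerD2l -mulrA; rewrite le_eqVlt; apply/orP; left; apply/eqP; congr (_ * _).
rewrite (@eq_Ex _ _ _ _ _ (fun S => \sum_(e | e \in s) [disjoint del e & S]%:R)); last first.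
  by move=> S0; rewrite -sum_count big_uniq ?(lr_uniq lr).
rewrite Ex_sum (eq_bigr (fun=> (1 - q) ^+ r)) => [|e es].
  rewrite -big_uniq ?(lr_uniq lr) //= big_const_seq count_predT iter_addr_0.
  by rewrite mulr_natl.
rewrite Ex_disjoint -(lr_card lr es); congr (_ ^+ _).
rewrite cardE -size_filter; apply/perm_size/uniq_perm; last 1 first.
- move=> v; rewrite mem_filter !mem_enum /=; apply/andP/idP => [[]//|ve]; split=> //.
  exact: (fintype.subsetP (lr_sub lr es)).
- by apply: filter_uniq; apply: enum_uniq.
- exact: enum_uniq.
Qed.

End Covers.

(** The numerical conditions under which a cover of at most [C * r] times the
    matching number exists: [T] is the density of some cover of all edges, [u1]
    the uncovered fraction under which that cover is used, and [theta] tunes the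
    density [1 - theta * u] of the random cover used for larger fractions [u]. *)
Record cover_parameters (R : realType) (r : nat) (C theta u1 T : R) : Prop := {
  cp_C : 0 < C <= 1;
  cp_theta : 1 <= theta;
  cp_u1 : 0 < u1 < 1;
  cp_empty : theta ^+ r.-1 <= r%:R * C;
  cp_random : 1 - C <= u1 * (theta - theta ^+ r / (r%:R * r.-1%:R) - C);
  cp_full : T <= C * (1 - u1) }.

Section MeanCover.
Variables (R : realType) (V E : finType) (s : seq E) (del : E -> {set V}).
Variables (X : {set V}) (r D : nat).
Hypothesis lr : linear_regular s del X r D.
Variables (C theta u1 T : R).
Hypothesis cp : cover_parameters r C theta u1 T.
Hypothesis r_gt1 : (1 < r)%N.
Hypothesis D_gt1 : (1 < D)%N.
Variable S0 : {set V}.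
Hypothesis S0X : S0 \subset X.
Hypothesis S0_full : forall e, e \in s -> ~~ [disjoint del e & S0].
Hypothesis S0_card : #|S0|%:R <= T * #|X|%:R.

Lemma full_cover_cost : count (fun e => [disjoint del e & S0]) s = 0%N.
Proof. by apply/eqP; rewrite eqn0Ngt -has_count; apply/hasPn. Qed.

Lemma handshake_density (p : R) : p * (size s)%:R = #|X|%:R * (p * D%:R / r%:R).
Proof.
have := handshake lr => /(congr1 (fun n => n%:R : R)); rewrite !natrM => hs.
have r0 : r%:R != 0 :> R by rewrite pnatr_eq0 -lt0n ltnW.
have -> : #|X|%:R * (p * D%:R / r%:R) = p * (#|X|%:R * D%:R) / r%:R by ring.
by rewrite -hs; field.
Qed.

(** In units of [#|X|], writing [c = p D], the empty set costs [c / r], and a random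
    set of density [1 - theta u] costs [1 - theta u + (c / r) (theta u) ^ r]; by the
    equation of [u] the last term is at most [theta ^ r u / (r (r - 1))], so that
    [c] disappears from the comparison with [1 - u]. *)
Lemma mean_cover_cost (p u : R) : 0 <= p -> 0 <= u <= 1 ->
  u ^+ r.-1 * (1 + r.-1%:R * (p * D%:R * (1 - D%:R^-1))) <= 1 ->
  exists2 S : {set V}, S \subset X &
    #|S|%:R + p * (count (fun e => [disjoint del e & S]) s)%:R
      <= #|X|%:R * (C * (1 - u) / (1 - D%:R^-1)).
Proof.
case: cp => /andP[C0 C1] th1 /andP[u10 u11] hE hR hF p0 /andP[u0 u1'] hu.
set eta := D%:R^-1 in hu *.
have eta1 : 0 < 1 - eta by rewrite subr_gt0 invf_lt1 ?ltr1n // ltr0n ltnW.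
have eta0 : 0 <= eta by rewrite invr_ge0.
set c := p * D%:R in hu *; have c0 : 0 <= c by rewrite mulr_ge0.
set m := r.-1 in hE hR hu *; set sc := c * (1 - eta) in hu.
have sc0 : 0 <= sc by rewrite mulr_ge0 // ltW.
have m0 : 0 < m%:R :> R by rewrite ltr0n /m -ltnS prednK // ltnW.
have r0 : 0 < r%:R :> R by rewrite ltr0n ltnW.
have um0 : 0 <= u ^+ m by rewrite exprn_ge0.
have hu' : m%:R * sc * u ^+ m <= 1 - u ^+ m by lra.
have X0 : 0 <= #|X|%:R :> R by [].
have wu : 0 <= 1 - u by rewrite subr_ge0.
have [thu|thu] := leP 1 (theta * u).
  exists finset.set0; first exact: finset.sub0set.
  rewrite cards0 add0r.
  apply: (@le_trans _ _ (p * (size s)%:R)); first by rewrite ler_wpM2l // ler_nat count_size.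
  rewrite handshake_density -/c ler_wpM2l // ler_pdivlMr //.
  have -> : c / r%:R * (1 - eta) = sc / r%:R by rewrite /sc; ring.
  have su : sc * u ^+ m <= 1 - u.
    rewrite -(ler_pM2l m0) mulrA; apply: le_trans hu' _.
    have q01 : 0 <= 1 - u <= 1 by rewrite wu gerBl.
    by have := one_sub_natmul_le m q01; rewrite subKr; lra.
  rewrite ler_pdivrMr //.
  apply: (@le_trans _ _ (theta ^+ m * (sc * u ^+ m))).
    rewrite mulrCA -exprMn; apply: ler_peMr => //; exact: exprn_ege1.
  apply: (@le_trans _ _ (theta ^+ m * (1 - u))).
    by rewrite ler_wpM2l // exprn_ge0 // (le_trans ler01).
  have := ler_wpM2r wu hE; lra.
have [uu1|uu1] := leP u1 u; last first.
  exists S0 => //; rewrite full_cover_cost mulr0 addr0.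
  apply: le_trans S0_card _; rewrite mulrC ler_wpM2l //.
  rewrite ler_pdivlMr //.
  have a1 : C * (1 - u1) <= C * (1 - u) by rewrite ler_wpM2l ?lerD2l ?lerN2 // ltW.
  have a2 : 0 <= C * (1 - u) by rewrite mulr_ge0 // ltW.
  apply: (@le_trans _ _ (C * (1 - u) * (1 - eta))).
    by apply: ler_wpM2r; [exact: ltW | exact: le_trans a1].
  by rewrite ler_piMr // gerBl.
have th0 : 0 <= theta by apply: le_trans th1.
have thu0 : 0 <= theta * u by rewrite mulr_ge0.
have q01 : 0 <= 1 - theta * u <= 1 by rewrite subr_ge0 (ltW thu) gerBl.
have [S SX hS] := random_cover lr p q01.
exists S => //; apply: le_trans hS _.
rewrite handshake_density -/c subKr -mulrA -mulrDr ler_wpM2l // ler_pdivlMr //.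
set A := theta - _ - C in hR.
have A0 : 0 <= A.
  by rewrite -(pmulr_rge0 _ u10); apply: le_trans hR; rewrite subr_ge0.
have hRu : 1 - C <= u * A by apply: le_trans hR _; rewrite ler_wpM2r.
have e1 : c / r%:R * (theta * u) ^+ r * (1 - eta) <= theta ^+ r / (r%:R * m%:R) * u.
  have -> : c / r%:R * (theta * u) ^+ r * (1 - eta) =
      (m%:R * sc * u ^+ m) * (theta ^+ r / (r%:R * m%:R) * u).
    rewrite exprMn /sc; have -> : u ^+ r = u * u ^+ m by rewrite -exprS prednK // ltnW.
    by field; rewrite ?gt_eqF.
  rewrite ler_piMl //; last by lra.
  by apply: mulr_ge0 => //; apply: divr_ge0; [exact: exprn_ge0 | exact: mulr_ge0].
have e2 : (1 - theta * u) * (1 - eta) <= 1 - theta * u.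
  by rewrite ler_piMr ?gerBl // subr_ge0 ltW.
rewrite mulrDl; apply: le_trans (lerD e2 e1) _.
move: hRu; rewrite /A; lra.
Qed.

End MeanCover.

(** * Concentration *)

Section Concentration.
Variables (R : realType) (V E : finType) (s : seq E) (del : E -> {set V}).
Local Notation ν G := ((matchnum del G)%:R : R).

Lemma matchnum_le_card (G : {set E}) : (matchnum del G <= #|G|)%N.
Proof. by apply/bigmax_leqP => K /andP[KG _]; apply: subset_leq_card. Qed.

Lemma cover_gap_lipschitz (a : R) (S : {set V}) : 0 <= a ->
  edge_lipschitz (1 + a) (fun G => (cover_cost del S G)%:R - a * ν G).
Proof.
move=> a0 e G.
have c1 : (cover_cost del S G <= cover_cost del S (e |: G))%N.
  rewrite leq_add2l; apply: subset_leq_card; apply/fintype.subsetP => x.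
  by rewrite !inE => /andP[-> ->]; rewrite orbT.
have c2 : (cover_cost del S (e |: G) <= (cover_cost del S G).+1)%N.
  rewrite /cover_cost -addnS leq_add2l.
  apply: (@leq_trans #|e |: [set e in G | [disjoint del e & S]]|).
    apply: subset_leq_card; apply/fintype.subsetP => x; rewrite !inE.
    by case: (x == e) => //= /andP[-> ->].
  by rewrite cardsU1 -add1n leq_add2r leq_b1.
have n1 : (matchnum del G <= matchnum del (e |: G))%N.
  by apply: matchnum_mono; apply: finset.subsetUr.
have n2 := matchnum_setU1 del e G.
move: c1 c2 n1 n2; rewrite -!(ler_nat R) -!natr1.
set x := (cover_cost _ _ _)%:R; set y := (cover_cost _ _ _)%:R.
set z := (matchnum _ _)%:R; set w := (matchnum _ _)%:R => h1 h2 h3 h4.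
have b1 : 0 <= a * (w - z) by rewrite mulr_ge0 // subr_ge0.
have b2 : a * (w - z) <= a by rewrite ler_piMr //; lra.
by rewrite ler_norml; apply/andP; split; lra.
Qed.

Lemma cover_gap_prob (a p m : R) (S : {set V}) : 0 <= a -> 0 <= p <= 1 -> 0 < m ->
  Ex p s (fun G => (cover_cost del S G)%:R) + m <= a * Ex p s (fun G => ν G) ->
  Ex p s (fun G => (a * ν G < (cover_cost del S G)%:R)%R%:R)
    <= (size s)%:R * p * (1 + a) ^+ 2 / m ^+ 2.
Proof.
move=> a0 p01 m0 hm; rewrite (@eq_Ex _ _ _ _ _
  (fun G => (0 < (cover_cost del S G)%:R - a * ν G)%R%:R)); last first.
  by move=> G; rewrite subr_gt0.
apply: Ex_chebyshev => //; first exact: cover_gap_lipschitz.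
by rewrite ExB ExZ; lra.
Qed.

(** When the expected number of edges exceeds the expected matching number by
    little, the edges are likely to form a matching. *)
Lemma edges_prob (a p : R) : uniq s -> 1 <= a -> 0 <= p <= 1 ->
  Ex p s (fun G => (a * ν G < (cover_cost del finset.set0 G)%:R)%R%:R)
    <= p * (size s)%:R - Ex p s (fun G => ν G).
Proof.
move=> us a1 p01; have <- : Ex p s (fun G => #|G|%:R) = p * (size s)%:R.
  rewrite -count_predT -Ex_card //; apply: eq_Ex => G; congr (_%:R).
  by apply: eq_card => e; rewrite inE andbT.
rewrite -ExB; apply: le_Ex => // G _.
have := matchnum_le_card G; case: ltP => [lt|_]; last by rewrite subr_ge0 ler_nat.
rewrite leq_eqVlt => /orP[/eqP eqG|]; last by rewrite -(ler_nat R) -natr1 /=; lra.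
move: lt; rewrite /cover_cost cards0 add0n.
have : (#|[set e in G | [disjoint del e & (finset.set0 : {set V})]]| <= #|G|)%N.
  by apply: subset_leq_card; apply/fintype.subsetP => e; rewrite inE => /andP[].
rewrite -(ler_nat R) -eqG => h1 h2.
have : ν G <= a * ν G by rewrite ler_peMl.
lra.
Qed.

End Concentration.


(** For average degrees [c <= c1], [greedy_err * c ^ 2 / D] bounds the error of the
    greedy estimate, and [greedy_rate * c] bounds [1 - u] from below. *)
Definition greedy_err (R : realType) (r : nat) (c1 : R) : R :=
  4 * r%:R ^+ 2 * expR (3 * r%:R * c1).
Definition greedy_rate (R : realType) (r : nat) (c1 : R) : R :=
  2^-1 / (1 + r.-1%:R * c1).

Lemma greedy_err_ge0 (R : realType) r (c1 : R) : 0 <= greedy_err r c1.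
Proof. by rewrite mulr_ge0 ?expR_ge0 // mulr_ge0 ?sqr_ge0. Qed.

Lemma greedy_rate_gt0 (R : realType) r (c1 : R) : 0 <= c1 -> 0 < greedy_rate r c1.
Proof. by move=> c10; rewrite divr_gt0 // ?invr_gt0 // ltr_pwDl // mulr_ge0. Qed.

Section RelativeBounds.
Variables (R : realType) (V E : finType) (s : seq E) (del : E -> {set V}).
Variables (X : {set V}) (r D : nat).
Hypothesis lr : linear_regular s del X r D.
Hypothesis r_gt1 : (1 < r)%N.
Hypothesis D_gt1 : (1 < D)%N.
Hypothesis rX : (r <= #|X|)%N.
Let m := r.-1.
Let eta : R := D%:R^-1.

Lemma eta_le_half : 0 < eta <= 2^-1.
Proof.
have D0 : 0 < D%:R :> R by rewrite ltr0n ltnW.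
by rewrite invr_gt0 D0 lef_pV2 ?posrE // (ler_nat _ 2).
Qed.

Lemma decay_lower (c u : R) : 0 <= c -> 0 <= u <= 1 -> u ^+ m * (1 + m%:R * c) <= 1 ->
  c <= (1 - u) * (1 + m%:R * c).
Proof.
move=> c0 /andP[u0 u1] hu.
have m0 : 0 < m%:R :> R by rewrite ltr0n /m -ltnS prednK // ltnW.
have q01 : 0 <= 1 - u <= 1 by rewrite subr_ge0 u1 gerBl.
have := one_sub_natmul_le m q01; rewrite subKr => hb.
have d0 : 0 <= 1 + m%:R * c by rewrite addr_ge0 // mulr_ge0.
have := le_trans (ler_wpM2r d0 hb) hu; rewrite -subr_le0 => hb'.
rewrite -(ler_pM2l m0) -subr_le0; apply: le_trans hb'.
by rewrite le_eqVlt; apply/orP; left; apply/eqP; ring.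
Qed.

Lemma Ex_matchnum_relative (c1 q : R) : 0 <= q <= 1 -> q * D%:R <= c1 ->
  exists u : R,
  [/\ 0 <= u <= 1,
      u ^+ m * (1 + m%:R * (q * D%:R * (1 - eta))) <= 1,
      greedy_rate r c1 * (q * D%:R) <= 1 - u,
      #|X|%:R * ((1 - u) * (1 - greedy_err r c1 * c1 / greedy_rate r c1 / D%:R))
        <= r%:R * Ex q s (fun G => (matchnum del G)%:R) &
      #|X|%:R / r%:R * (q * D%:R)
        * (1 - eta - m%:R * (q * D%:R) - greedy_err r c1 * (q * D%:R) / D%:R)
        <= Ex q s (fun G => (matchnum del G)%:R)].
Proof.
move=> q01 qc1; have /andP[q0 _] := q01.
have r_gt0 : (0 < r)%N by apply: ltnW.
have D_gt0 : (0 < D)%N by apply: ltnW.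
have [u [u01 hu] p] := Ex_matchnum_ge lr r_gt0 D_gt0 rX q01 qc1.
rewrite -/m -/eta in hu; rewrite -/(greedy_err r c1) in p; exists u; have /andP[u0 u1] := u01.
set K := greedy_err r c1 in p *; set kap := greedy_rate r c1.
set Enu := Ex q s _ in p *; set c := q * D%:R in qc1 hu p *.
have K0 : 0 <= K := greedy_err_ge0 r c1.
have dD0 : 0 < D%:R :> R by rewrite ltr0n.
have r0 : 0 < r%:R :> R by rewrite ltr0n.
have c0 : 0 <= c by rewrite mulr_ge0.
have c10 : 0 <= c1 by apply: le_trans qc1.
have kap0 : 0 < kap := greedy_rate_gt0 r c10.
have /andP[eta0 eta2] := eta_le_half.
clearbody K eta c Enu; move: eta0 eta2 => eta0 eta2.
have hnu : #|X|%:R * (1 - u - K * c ^+ 2 / D%:R) <= r%:R * Enu.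
  have := ler_wpM2l (ltW r0) p; rewrite mulrA [r%:R * (_ / _)]mulrC divfK ?gt_eqF //.
set sc := c * (1 - eta) in hu.
have w0 : 0 <= 1 - u by rewrite subr_ge0.
have e1 : 0 <= 1 - eta by lra.
have sc0 : 0 <= sc by rewrite mulr_ge0.
have scc : sc <= c by rewrite ler_piMr // gerBl ltW.
have sc2 : c / 2 <= sc by rewrite /sc ler_wpM2l //; lra.
have hw := decay_lower sc0 u01 hu.
have hk : kap * c <= 1 - u.
  have -> : kap * c = (c / 2) / (1 + m%:R * c1) by rewrite /kap /greedy_rate -/m; ring.
  rewrite ler_pdivrMr; last by rewrite ltr_pwDl // mulr_ge0.
  apply: le_trans sc2 _; apply: le_trans hw _.
  apply: ler_wpM2l => //; rewrite lerD2l; apply: ler_wpM2l => //.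
  exact: le_trans qc1.
have Kc : K * c ^+ 2 / D%:R <= K * c1 / kap / D%:R * (1 - u).
  have -> : K * c ^+ 2 / D%:R = (K * c / D%:R) * c by ring.
  have -> : K * c1 / kap / D%:R * (1 - u) = (K * c1 / D%:R) * ((1 - u) / kap) by ring.
  apply: ler_pM => //; first by rewrite divr_ge0 // mulr_ge0.
    by rewrite ler_wpM2r ?invr_ge0 // ler_wpM2l.
  by rewrite ler_pdivlMr // mulrC.
split=> //.
- apply: le_trans hnu; apply: ler_wpM2l => //.
  rewrite mulrBr mulr1 lerD2l lerN2 [leRHS]mulrC //.
- apply: le_trans p; rewrite -mulrA; apply: ler_wpM2l; first by rewrite divr_ge0 // ltW.
  have h1 : sc - m%:R * sc ^+ 2 <= 1 - u.
    have a0 : 0 <= m%:R * sc by rewrite mulr_ge0.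
    have a1 := ler_wpM2l a0 hw.
    have a2 : 0 <= (1 - u) * (m%:R * sc) ^+ 2 by rewrite mulr_ge0 // sqr_ge0.
    move: a1 a2 hw; set a := m%:R * sc => a1 a2 hw'.
    have -> : m%:R * sc ^+ 2 = a * sc by rewrite /a; ring.
    (* [sc (1 - a) <= (1 - u) (1 - a ^ 2)] if [a <= 1]; otherwise the left side is
       not positive *)
    have [al|al] := leP a 1.
      have : (1 - a) * sc <= (1 - a) * ((1 - u) * (1 + a)).
        by rewrite ler_wpM2l // subr_ge0.
      lra.
    have : sc <= a * sc by rewrite ler_peMl // ltW.
    lra.
  have h2 : m%:R * sc ^+ 2 <= m%:R * c ^+ 2.
    by apply: ler_wpM2l => //; apply: lerXn2r.
  have -> : c * (1 - eta - m%:R * c - K * c / D%:R) =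
    sc - m%:R * c ^+ 2 - K * c ^+ 2 / D%:R by rewrite /sc; ring.
  lra.
Qed.

End RelativeBounds.

Section FewFailures.
Variables (R : realType) (r : nat) (C1 C2 C theta u1 T : R).
Hypothesis r_gt2 : (2 < r)%N.
Hypothesis cp : cover_parameters r C1 theta u1 T.
Hypothesis C12 : C1 < C2.
Hypothesis C2C : C2 < C.
Hypothesis Cr : 1 <= C * r%:R.

Let m := r.-1.
(* Above the average degree [c1] the full cover is used. *)
Let c1 : R := 2 / u1 ^+ m.
Let K := greedy_err r c1.
Let kap := greedy_rate r c1.
Let B := K * c1 / kap.
Let L := 1 + C * r%:R.
Let g := (C - C2) * (kap * r%:R / 2).
Let g1 := (C - C2) * (kap * c1 / 2).

Let r_gt1 : (1 < r)%N := ltnW r_gt2.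
Let r_gt0 : (0 < r)%N := ltnW r_gt1.

Let c1_gt0 : 0 < c1.
Proof. by case: cp => _ _ /andP[u10 _] _ _ _; rewrite divr_gt0 // exprn_gt0. Qed.

Let K_ge0 : 0 <= K. Proof. exact: greedy_err_ge0. Qed.

Let kap_gt0 : 0 < kap. Proof. by apply: greedy_rate_gt0; apply: ltW. Qed.

Let B_ge0 : 0 <= B.
Proof. by apply: divr_ge0; [apply: mulr_ge0 => //; apply: ltW | apply: ltW]. Qed.

Let C2_gt0 : 0 < C2.
Proof. by case: cp => /andP[C10 _] _ _ _ _ _; apply: lt_trans C12. Qed.

Let gap_gt0 : 0 < C - C2. Proof. by rewrite subr_gt0. Qed.

Let g_gt0 : 0 < g.
Proof.
apply: mulr_gt0 => //; apply: divr_gt0 => //; apply: mulr_gt0 => //.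
by rewrite ltr0n.
Qed.

Let g1_gt0 : 0 < g1.
Proof. by apply: mulr_gt0 => //; apply: divr_gt0 => //; apply: mulr_gt0. Qed.

Lemma ratio_bound (x d : R) : 0 <= x -> 2 <= d -> C2 * (1 + B) <= (C2 - C1) * d ->
  C1 * x / (1 - d^-1) <= C2 * (x * (1 - B / d)).
Proof.
move: B B_ge0 C2 C2_gt0 C1 => b b0 c c0 c' x0 d2 hd.
have d0 : 0 < d by apply: lt_le_trans d2.
have e0 : 0 < d^-1 by rewrite invr_gt0.
have e2 : d^-1 <= 2^-1 by rewrite lef_pV2 ?posrE.
have h3 : 1 - (1 + b) / d <= (1 - b / d) * (1 - d^-1).
  rewrite (_ : (1 - b / d) * (1 - d^-1) = 1 - (1 + b) / d + b / d * d^-1).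
    by rewrite lerDl mulr_ge0 ?divr_ge0 // ltW.
  by ring.
have h4 : c * (1 + b) / d <= c - c' by rewrite ler_pdivrMr.
have h5 : c' <= c * ((1 - b / d) * (1 - d^-1)).
  apply: le_trans (ler_wpM2l (ltW c0) h3).
  by rewrite mulrBr mulr1 mulrA; lra.
rewrite ler_pdivrMr; last by lra.
have := ler_wpM2r x0 h5; lra.
Qed.

Variables (V E : finType) (s : seq E) (del : E -> {set V}) (X S0 : {set V}) (D : nat).
Hypothesis lr : linear_regular s del X r D.
Hypothesis D_gt1 : (1 < D)%N.
Hypothesis rX : (r <= #|X|)%N.
Hypothesis S0X : S0 \subset X.
Hypothesis S0_full : forall e, e \in s -> ~~ [disjoint del e & S0].
Hypothesis S0_card : #|S0|%:R <= T * #|X|%:R.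
Hypothesis D_ratio : C2 * (1 + B) <= (C2 - C1) * D%:R.
Hypothesis D_half : 2 * B <= D%:R.

Local Notation ν := (fun G : {set E} => (matchnum del G)%:R : R).
Local Notation failure p S :=
  (Ex p s (fun G => (C * r%:R * (matchnum del G)%:R < (cover_cost del S G)%:R)%R%:R)).

Let D_gt0 : (0 < D)%N := ltnW D_gt1.
Let dD_gt0 : 0 < D%:R :> R. Proof. by rewrite ltr0n. Qed.
Let dr_gt0 : 0 < r%:R :> R. Proof. by rewrite ltr0n. Qed.
Let dX_gt0 : 0 < #|X|%:R :> R. Proof. by rewrite ltr0n; apply: leq_trans rX. Qed.
Let D_ge2 : 2 <= D%:R :> R. Proof. by rewrite (ler_nat _ 2). Qed.
Let C_ge0 : 0 <= C * r%:R. Proof. exact: le_trans Cr. Qed.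

(** The relative error of the greedy estimate is absorbed by the passage from [C1]
    to [C2]. *)
Lemma gap_at (q : R) : 0 <= q <= 1 -> q * D%:R <= c1 -> exists u : R,
  [/\ 0 <= u <= 1,
      u ^+ m * (1 + m%:R * (q * D%:R * (1 - D%:R^-1))) <= 1,
      #|X|%:R * (C1 * (1 - u) / (1 - D%:R^-1)) <= C2 * (r%:R * Ex q s ν),
      #|X|%:R * (kap * (q * D%:R) / 2) <= r%:R * Ex q s ν &
      #|X|%:R / r%:R * (q * D%:R) * (1 - D%:R^-1 - m%:R * (q * D%:R) - K * (q * D%:R) / D%:R)
        <= Ex q s ν].
Proof.
move=> q01 qc1; have [u [u01 hu hk h1 h2]] := Ex_matchnum_relative lr r_gt1 D_gt1 rX q01 qc1.
exists u; split=> //.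
  apply: le_trans (ler_wpM2l (ltW C2_gt0) h1); rewrite [leRHS]mulrCA ler_wpM2l //.
  by apply: ratio_bound => //; rewrite subr_ge0; case/andP: u01.
apply: le_trans h1; rewrite ler_wpM2l //.
have w0 : 0 <= 1 - u by rewrite subr_ge0; case/andP: u01.
apply: (@le_trans _ _ ((1 - u) / 2)); first by rewrite ler_wpM2r.
rewrite ler_wpM2l // -/K -/kap -/B.
have : B / D%:R <= 2^-1 by rewrite ler_pdivrMr // mulrC ler_pdivlMr // mulrC.
move: (B / D%:R) => x xle; lra.
Qed.

(** When many edges are expected, the gap between the means, of the order of the
    expected number of edges, exceeds the standard deviation, of the order of its
    square root. *)
Lemma failure_many (p delta : R) : 0 < delta -> 0 <= p <= 1 -> p * D%:R <= c1 ->
  L ^+ 2 / (g ^+ 2 * delta) <= p * (size s)%:R ->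
  exists2 S : {set V}, S \subset X & failure p S <= delta.
Proof.
move=> delta0 p01 pc1 lam_large; have /andP[p0 p1] := p01.
have [u [u01 hu h1 h2 _]] := gap_at p01 pc1.
have [S SX hS] := mean_cover_cost lr cp r_gt1 D_gt1 S0X S0_full S0_card p0 u01 hu.
exists S => //.
have L0 : 0 < L by rewrite /L ltr_pwDl.
have lam0 : 0 < p * (size s)%:R.
  by apply: lt_le_trans lam_large; rewrite divr_gt0 ?exprn_gt0 // mulr_gt0 // exprn_gt0.
pose mm := g * (p * (size s)%:R).
have mm0 : 0 < mm by rewrite mulr_gt0.
apply: le_trans (cover_gap_prob C_ge0 p01 mm0 _) _.
  rewrite (Ex_cover_cost lr); apply: le_trans (lerD (le_trans hS h1) (lexx mm)) _.
  have : mm <= (C - C2) * (r%:R * Ex p s ν).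
    rewrite /mm /g -mulrA; apply: ler_wpM2l; first exact: ltW.
    apply: le_trans h2; rewrite (handshake_density lr) //.
    by rewrite le_eqVlt; apply/orP; left; apply/eqP; field; rewrite gt_eqF.
  lra.
rewrite -/L ler_pdivrMr ?exprn_gt0 // /mm exprMn.
have : L ^+ 2 <= (p * (size s)%:R) * (g ^+ 2 * delta).
  by rewrite -ler_pdivrMr // mulr_gt0 // exprn_gt0.
move/(ler_wpM2l (ltW lam0)); rewrite [(size s)%:R * p]mulrC => hL.
by apply: le_trans hL _; rewrite le_eqVlt; apply/orP; left; apply/eqP; ring.
Qed.

(** When few edges are expected, two of them are unlikely to meet; the expected
    loss [|G| - nu], read off the greedy estimate, bounds the probability. *)
Lemma failure_few (p lam1 x : R) : 0 <= p <= 1 -> p * D%:R <= c1 ->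
  p * (size s)%:R <= lam1 -> x <= D%:R -> x <= #|X|%:R -> 0 < x ->
  exists2 S : {set V}, S \subset X &
    failure p S <= (lam1 + r%:R * lam1 ^+ 2 * (m%:R + K)) / x.
Proof.
move=> p01 pc1 lam_small xD xX x0; have /andP[p0 p1] := p01.
have [u [_ _ _ _ h]] := gap_at p01 pc1.
exists finset.set0; first exact: finset.sub0set.
apply: le_trans (edges_prob del (lr_uniq lr) Cr p01) _.
have lamE : p * (size s)%:R = #|X|%:R / r%:R * (p * D%:R).
  by rewrite (handshake_density lr) //; ring.
rewrite -lamE in h.
have cE : p * D%:R = r%:R * (p * (size s)%:R) / #|X|%:R.
  by rewrite lamE; field; rewrite !gt_eqF.
have lam0 : 0 <= p * (size s)%:R by rewrite mulr_ge0.
move: lam_small h; rewrite cE; move: (p * _) lam0 => lam lam0 lam_small h.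
have Di1 : D%:R^-1 <= 1 :> R by rewrite invf_le1 // ler1n.
apply: le_trans (lerB (lexx _) h) _.
set c := r%:R * lam / #|X|%:R.
have c0 : 0 <= c by rewrite divr_ge0 // mulr_ge0.
have -> : lam - lam * (1 - D%:R^-1 - m%:R * c - K * c / D%:R) =
  lam * D%:R^-1 + lam * (c * (m%:R + K * D%:R^-1)) by ring.
rewrite mulrDl; apply: lerD.
  by apply: ler_pM => //; rewrite lef_pV2 ?posrE.
have l2 : lam * (r%:R * lam) <= r%:R * lam1 ^+ 2.
  rewrite mulrCA ler_wpM2l //; apply: ler_pM => //.
have mK : m%:R + K * D%:R^-1 <= m%:R + K by rewrite lerD2l ler_piMr.
rewrite (_ : lam * _ = (lam * (r%:R * lam)) * (m%:R + K * D%:R^-1) * #|X|%:R^-1); last first.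
  by rewrite /c; ring.
have mK0 : 0 <= m%:R + K * D%:R^-1 by rewrite addr_ge0 // mulr_ge0.
have ll0 : 0 <= lam * (r%:R * lam) by rewrite !mulr_ge0.
apply: ler_pM => //; first exact: mulr_ge0.
  exact: ler_pM.
by rewrite lef_pV2 ?posrE.
Qed.

(** Beyond degree [c1] the full cover is compared with the greedy matching of a
    thinner random set, of degree [c1], which already leaves a fraction below [u1]
    uncovered. *)
Lemma failure_dense (p x : R) : 0 <= p <= 1 -> c1 < p * D%:R ->
  x * D%:R <= #|X|%:R -> 0 < x ->
  exists2 S : {set V}, S \subset X & failure p S <= L ^+ 2 / (r%:R * g1 ^+ 2) / x.
Proof.
move=> p01 pc1 xX x0; have /andP[p0 p1] := p01.
have [/andP[C10 _] _ /andP[u10 _] _ _ hF] := cp.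
pose p' := c1 / D%:R.
have p'0 : 0 <= p' by rewrite divr_ge0 // ltW.
have p'p : p' <= p by rewrite ler_pdivrMr // ltW.
have p'01 : 0 <= p' <= 1 by rewrite p'0 (le_trans p'p).
have p'D : p' * D%:R = c1 by rewrite divfK // gt_eqF.
have p'c1 : p' * D%:R <= c1 by rewrite p'D.
have [u [u01 hu h1 h2 _]] := gap_at p'01 p'c1; have /andP[u0 u1'] := u01.
rewrite p'D in hu h2.
have eta2 : D%:R^-1 <= 2^-1 :> R by rewrite lef_pV2 ?posrE.
have uu1 : u < u1.
  rewrite ltNge; apply/negP => le_u; move: hu; apply/negP; rewrite -ltNge.
  have m1 : 1 <= m%:R :> R by rewrite ler1n /m -ltnS prednK.
  have uum : u1 ^+ m <= u ^+ m by rewrite lerXn2r ?nnegrE // ltW.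
  have um0 : 0 < u1 ^+ m by rewrite exprn_gt0.
  apply: (@lt_le_trans _ _ (u1 ^+ m * (1 + c1 / 2))).
    rewrite /c1 mulrDr mulr1 mulrA [u1 ^+ m * (2 / _)]mulrC divfK ?gt_eqF //.
    by rewrite divff // ltrDr.
  apply: ler_pM => //; first exact: ltW.
    by rewrite addr_ge0 // divr_ge0 // ltW.
  rewrite lerD2l; apply: (@le_trans _ _ (c1 * (1 - D%:R^-1))).
    by apply: ler_wpM2l; [exact: ltW | lra].
  by apply: ler_peMl => //; apply: mulr_ge0; [exact: ltW | lra].
exists S0 => //.
have mono : Ex p' s ν <= Ex p s ν.
  by apply: Ex_mono_p => // G G' GG'; rewrite ler_nat matchnum_mono.
pose mm := g1 * #|X|%:R.
have mm0 : 0 < mm by rewrite mulr_gt0.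
apply: le_trans (cover_gap_prob C_ge0 p01 mm0 _) _.
  rewrite (Ex_cover_cost lr) (full_cover_cost S0_full) mulr0 addr0.
  have a1 : #|S0|%:R <= C2 * (r%:R * Ex p' s ν).
    apply: le_trans h1; apply: le_trans S0_card _; rewrite mulrC ler_wpM2l //.
    have e0 : 0 < 1 - D%:R^-1 :> R by lra.
    rewrite ler_pdivlMr //; apply: (@le_trans _ _ (C1 * (1 - u) * (1 - D%:R^-1))).
      rewrite ler_wpM2r ?(ltW e0) //; apply: le_trans hF _.
      by rewrite ler_wpM2l ?(ltW C10) // lerD2l lerN2 ltW.
    rewrite ler_piMr ?gerBl ?invr_ge0 //.
    by rewrite mulr_ge0 ?(ltW C10) // subr_ge0.
  have a2 : mm <= (C - C2) * (r%:R * Ex p' s ν).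
    rewrite /mm /g1 -mulrA; apply: ler_wpM2l; first exact: ltW.
    by rewrite mulrC.
  have a3 : C * r%:R * Ex p' s ν <= C * r%:R * Ex p s ν by rewrite ler_wpM2l.
  lra.
rewrite -/L ler_pdivrMr ?exprn_gt0 // /mm.
have -> : L ^+ 2 / (r%:R * g1 ^+ 2) / x * (g1 * #|X|%:R) ^+ 2 =
  L ^+ 2 * (#|X|%:R / r%:R * (#|X|%:R / x)).
  by field; rewrite !gt_eqF.
rewrite mulrC ler_wpM2l ?sqr_ge0 //.
rewrite [_ * p]mulrC (handshake_density lr) //.
have -> : #|X|%:R * (p * D%:R / r%:R) = #|X|%:R / r%:R * (p * D%:R) by ring.
apply: ler_wpM2l; first by rewrite divr_ge0.
rewrite ler_pdivlMr //; apply: le_trans xX; rewrite [leRHS]mulrC.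
by apply: ler_wpM2r; [exact: ltW | rewrite ler_piMl].
Qed.

End FewFailures.

Lemma leq_addends (a b c d e f : nat) (n := (a + b + c + d + e + f)%N) :
  [/\ (a <= n)%N, (b <= n)%N, (c <= n)%N & [/\ (d <= n)%N, (e <= n)%N & (f <= n)%N]].
Proof. by rewrite /n; split; [lia | lia | lia | split; lia]. Qed.

(** The three ranges of the density together; [D0] depends on [r], on the
    parameters and on [delta], neither on the hypergraph nor on the density. *)
Lemma few_failures (R : realType) (r : nat) (C1 C theta u1 T : R) : (2 < r)%N ->
  cover_parameters r C1 theta u1 T -> C1 < C -> 1 <= C * r%:R ->
  forall delta : R, 0 < delta -> exists D0 : nat,
  forall (V E : finType) (s : seq E) (del : E -> {set V}) (X S0 : {set V}) (D : nat),
  linear_regular s del X r D -> (D0 <= D)%N -> (D0 * D <= #|X|)%N ->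
  S0 \subset X -> (forall e, e \in s -> ~~ [disjoint del e & S0]) ->
  #|S0|%:R <= T * #|X|%:R ->
  forall p : R, 0 <= p <= 1 -> exists2 S : {set V}, S \subset X &
  Ex p s (fun G => (C * r%:R * (matchnum del G)%:R < (cover_cost del S G)%:R)%R%:R) <= delta.
Proof.
move=> r_gt2 cp C1C Cr delta delta0.
pose C2 := (C + C1) / 2.
have C12 : C1 < C2 by rewrite /C2; lra.
have C2C : C2 < C by rewrite /C2; lra.
set c1 : R := 2 / u1 ^+ r.-1.
set K := greedy_err r c1; set kap := greedy_rate r c1; set B := K * c1 / kap.
set L := 1 + C * r%:R.
set g := (C - C2) * (kap * r%:R / 2); set g1 := (C - C2) * (kap * c1 / 2).
pose y1 := C2 * (1 + B) / (C2 - C1).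
pose lam1 := L ^+ 2 / (g ^+ 2 * delta).
pose z3 := lam1 + r%:R * lam1 ^+ 2 * (r.-1%:R + K).
pose y3 := `|z3| / delta + 1.
pose y4 := L ^+ 2 / (r%:R * g1 ^+ 2) / delta.
pose D0 := (2 + r + Num.bound y1 + Num.bound (2 * B) + Num.bound y3 + Num.bound y4)%N.
have [D2 Dr Dy1 [D2B Dy3 Dy4]] := leq_addends 2 r (Num.bound y1) (Num.bound (2 * B))
  (Num.bound y3) (Num.bound y4).
rewrite -/D0 in D2 Dr Dy1 D2B Dy3 Dy4.
clearbody D0.
have bnd (y : R) n : (Num.bound y <= n)%N -> y <= n%:R.
  move=> yn; apply: le_trans (ler_norm y) (ltW _).
  by apply: lt_le_trans (archi_boundP (normr_ge0 y)) _; rewrite ler_nat /Num.bound normr_id in yn *.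
exists D0 => V E s del X S0 D lr DD0 XD0 S0X S0f S0c p p01.
have D_gt1 : (1 < D)%N by apply: leq_trans DD0.
have D0X : (D0 <= #|X|)%N.
  by apply: leq_trans XD0; rewrite leq_pmulr // ltnW.
have rX : (r <= #|X|)%N by apply: leq_trans D0X.
have f1 : C2 * (1 + B) <= (C2 - C1) * D%:R.
  rewrite mulrC [leRHS]mulrC -ler_pdivrMr ?subr_gt0 // [X in X / _]mulrC.
  by apply: bnd; apply: leq_trans DD0.
have f2 : 2 * B <= D%:R.
  by apply: bnd; apply: leq_trans DD0.
have y3D : y3 <= D%:R by apply: bnd; apply: leq_trans DD0.
have y3X : y3 <= #|X|%:R by apply: bnd; apply: leq_trans D0X.
have y30 : 0 < y3 by rewrite ltr_wpDl // divr_ge0 // ltW.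
have y4D : y4 <= D0%:R by apply: bnd.
have D0gt0 : 0 < D0%:R :> R by rewrite ltr0n; apply: leq_trans D2.
have XD : D0%:R * D%:R <= #|X|%:R :> R by rewrite -natrM ler_nat.
have [pc1|pc1] := leP (p * D%:R) c1.
  have [lam_large|lam_small] := leP lam1 (p * (size s)%:R).
    exact: (failure_many r_gt2 cp C12 C2C Cr lr D_gt1 rX S0X S0f S0c f1 f2 delta0 p01 pc1 lam_large).
  have [S SX hS] := failure_few r_gt2 cp C12 Cr lr D_gt1 rX f1 f2 p01 pc1 (ltW lam_small) y3D y3X y30.
  exists S => //; apply: le_trans hS _; rewrite -/K -/z3 ler_pdivrMr // /y3.
  rewrite mulrDr mulr1 mulrCA divff ?gt_eqF // mulr1.
  by apply: le_trans (ler_norm z3) _; rewrite lerDl ltW.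
have [S SX hS] :=
  failure_dense r_gt2 cp C12 C2C Cr lr D_gt1 rX S0X S0f S0c f1 f2 p01 pc1 XD D0gt0.
exists S => //; apply: le_trans hS _; rewrite -/c1 -/kap -/L -/g1.
by rewrite ler_pdivrMr // [leRHS]mulrC -ler_pdivrMr.
Qed.

(** * Covering all [r]-sets by few [(r-1)]-sets *)

Section FranklRodl.
Variables (V : finType) (r l : nat).
Hypothesis r_gt1 : (1 < r)%N.

Implicit Types (chi : {ffun V -> 'I_l.+1}) (b e : {set V}) (a : 'I_l.+1).

Definition weight chi b : 'I_l.+1 := \sum_(x in b) chi x.
Definition missing chi b : {set 'I_l.+1} := ~: (chi @: b).

Definition shifted_cover chi a : {set {set V}} :=
  [set b in ksets V r.-1 | ((weight chi b + a)%R <= #|missing chi b|)%N].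

(** Removing [x] from [e] lowers the weight by the colour of [x]; if [e] misses [d]
    colours this produces [l + 1 - d] residues, which cannot all avoid the [d + 1]
    residues [0, ..., d]. *)
Lemma shifted_cover_meets chi a e : e \in ksets V r ->
  exists2 b, b \in shifted_cover chi a & b \subset e.
Proof.
rewrite inE => /eqP er.
pose I := [set weight chi e - j + a | j in chi @: e].
pose J := [set k : 'I_l.+1 | (k <= #|missing chi e|)%N].
have cI : #|I| = #|chi @: e| by apply: card_imset => x y /addIr /addrI /oppr_inj.
have e0 : (0 < #|chi @: e|)%N.
  by rewrite card_gt0 imset_eq0 -card_gt0 er; apply: ltnW.
have cm : (#|missing chi e| + #|chi @: e| = l.+1)%N.
  by rewrite addnC /missing cardsC card_ord.
have cJ : #|J| = #|missing chi e|.+1.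
  have lm : (#|missing chi e| < l.+1)%N by lia.
  have wI : injective (widen_ord lm) by move=> i j /(congr1 val) /= ij; apply: val_inj.
  rewrite -[RHS]card_ord -(card_imset _ wI); apply: eq_card => k.
  rewrite !inE; apply/idP/imsetP => [km|[i _ ->]]; last by rewrite /= -ltnS.
  by exists (Ordinal (km : k < #|missing chi e|.+1)%N) => //; apply: val_inj.
have : I :&: J != finset.set0.
  apply/negP => /eqP IJ; have := cardsUI I J; rewrite IJ cards0 addn0 cI cJ.
  have : (#|I :|: J| <= l.+1)%N by rewrite -[X in (_ <= X)%N]card_ord max_card.
  by move: cm; clear; lia.
case/set0Pn => k; rewrite inE => /andP[/imsetP[j /imsetP[x xe ->] ->]].
rewrite inE => hJ; exists (e :\ x); last exact: finset.subsetDl.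
have we : weight chi (e :\ x) = weight chi e - chi x.
  by rewrite /weight (big_setD1 x xe) /= addrC addrK.
rewrite !inE we.
have -> : #|e :\ x| == r.-1 by rewrite -er (cardsD1 x e) xe.
rewrite andTb; apply: leq_trans hJ _.
 apply: subset_leq_card; rewrite finset.setCS.
by apply: finset.imsetS; apply: finset.subsetDl.
Qed.

(** For each colour, the colourings that avoid it on [b] are counted. *)
Lemma sum_missing b : (\sum_chi #|missing chi b| =
  l.+1 * (l ^ #|b| * l.+1 ^ (#|V| - #|b|)))%N.
Proof.
under eq_bigr => chi _ do rewrite -sum1_card big_mkcond /=.
rewrite exchange_big /= -[in RHS](card_ord l.+1) -sum_nat_const.
apply: eq_bigr => j _.
rewrite -big_mkcond /= sum1dep_card.
pose F (x : V) : {set 'I_l.+1} := if x \in b then ~: [set j] else finset.setT.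
rewrite (eq_card (B := family F)) => [|chi]; last first.
  rewrite finset.in_set finset.in_setC; apply/idP/familyP => [jb x|Fx].
    rewrite /F; case: ifP => [xb|_]; last by rewrite inE.
    by rewrite !inE; apply: contra jb => /eqP <-; apply: imset_f.
  apply/imsetP => -[x xb jx]; have := Fx x.
  by rewrite /F xb !inE jx eqxx.
rewrite card_family foldrE big_map big_enum /=.
rewrite (bigID [in b]) /=; congr (_ * _)%N.
  rewrite (eq_bigr (fun=> l)) ?prod_nat_const // => x xb.
  by rewrite /F xb cardsC1 card_ord.
rewrite (eq_bigr (fun=> l.+1)) => [|x /negbTE xb]; last by rewrite /F xb cardsT card_ord.
rewrite prod_nat_const; congr (_ ^ _)%N; first by rewrite card_ord.
by rewrite -(cardC [in b]) addKn; apply: eq_card => x; rewrite !inE.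
Qed.

Lemma sum_shift chi b : (\sum_a ((weight chi b + a)%R <= #|missing chi b|) <= #|missing chi b|.+1)%N.
Proof.
have cJ d : (\sum_(k < l.+1) (k <= d) <= d.+1)%N.
  have -> : (\sum_(k < l.+1) (k <= d) = \sum_(0 <= k < l.+1) (k <= d))%N.
    by rewrite big_mkord.
  elim: l => [|n IH]; first by rewrite big_nat1.
  rewrite big_nat_recr //=; case: (leqP n.+1 d) => nd; last by rewrite addn0.
  rewrite addn1 ltnS; apply: leq_trans nd.
  apply: (@leq_trans (\sum_(0 <= k < n.+1) 1)); last by rewrite sum_nat_const_nat subn0 muln1.
  by apply: leq_sum => k _; apply: leq_b1.
rewrite (reindex_inj (addrI (- weight chi b))).
apply: leq_trans (cJ _); apply/eq_leq; apply: eq_bigr => a _.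
by rewrite addrA subrr add0r.
Qed.

(** At most [missing + 1] of the [l + 1] shifts contain a given set, and a random
    colouring makes it miss each colour with probability
    [(1 - 1/(l+1)) ^ (r-1)]; some colouring and shift do as well as the average. *)
Lemma small_cover (R : realType) : exists S : {set {set V}},
  [/\ S \subset ksets V r.-1,
      forall e, e \in ksets V r -> exists2 b, b \in S & b \subset e &
      #|S|%:R <= (l.+1%:R^-1 + (1 - l.+1%:R^-1) ^+ r.-1) * #|ksets V r.-1|%:R :> R].
Proof.
set T : R := _ + _.
have [/existsP[chi /existsP[a small]]|none] := boolP [exists chi, exists a,
    (#|shifted_cover chi a|%:R <= T * #|ksets V r.-1|%:R)].
  exists (shifted_cover chi a); split => //.
    by apply/fintype.subsetP => b; rewrite inE => /andP[].
  by move=> e; apply: shifted_cover_meets.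
have big chi a : T * #|ksets V r.-1|%:R < #|shifted_cover chi a|%:R.
  rewrite ltNge; apply: contra none => small.
  by apply/existsP; exists chi; apply/existsP; exists a.
have : \sum_(chi : {ffun V -> 'I_l.+1}) \sum_(a < l.+1) (T * #|ksets V r.-1|%:R) < \sum_chi \sum_a #|shifted_cover chi a|%:R.
  have pchi : has predT (index_enum {ffun V -> 'I_l.+1}).
    by apply/hasP; exists [ffun=> ord0] => //; rewrite mem_index_enum.
  have pa : has predT (index_enum 'I_l.+1).
    by apply/hasP; exists ord0 => //; rewrite mem_index_enum.
  by apply: (ltr_sum pchi) => chi _; apply: (ltr_sum pa) => a _; apply: big.
rewrite ltNge => /negP[].
rewrite !sumr_const card_ffun card_ord.
have -> : \sum_chi \sum_a #|shifted_cover chi a|%:R =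
  \sum_(b in ksets V r.-1) \sum_chi \sum_a ((weight chi b + a)%R <= #|missing chi b|)%N%:R :> R.
  rewrite [RHS]exchange_big; apply: eq_bigr => chi _.
  rewrite [RHS]exchange_big; apply: eq_bigr => a _.
  rewrite -sum1_card natr_sum big_mkcond [RHS]big_mkcond; apply: eq_bigr => b _.
  by rewrite !inE; case: (_ == _); case: (_ <= _)%N.
apply: (@le_trans _ _ (\sum_(b in ksets V r.-1) (l.+1%:R ^+ #|V| * (l.+1%:R * T)))); last first.
  rewrite sumr_const -[leLHS]mulr_natr -[leRHS]mulr_natr -[X in _ <= X * _]mulr_natr natrX.
  by rewrite le_eqVlt; apply/orP; left; apply/eqP; ring.
apply: ler_sum => b; rewrite inE => /eqP bk.
apply: (@le_trans _ _ (\sum_chi (#|missing chi b|.+1)%:R)).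
  by apply: ler_sum => chi _; rewrite -natr_sum ler_nat sum_shift.
under eq_bigr => chi _ do rewrite -natr1.
rewrite big_split /= -natr_sum sum_missing bk sumr_const card_ffun card_ord.
have kV : (r.-1 <= #|V|)%N by rewrite -bk max_card.
rewrite -[#|V|](subnKC kV); move: (#|V| - r.-1)%N => d; rewrite addKn.
have x0 : l.+1%:R != 0 :> R by rewrite pnatr_eq0.
rewrite /T; have -> : 1 - l.+1%:R^-1 = l%:R / l.+1%:R :> R.
  by rewrite -natr1 in x0 *; field.
rewrite natrM natrM !natrX exprD expr_div_n le_eqVlt; apply/orP; left; apply/eqP.
by field; rewrite expf_neq0 //= [1 + _]addrC natr1.
Qed.

End FranklRodl.

(** * The hypergraph of [r]-sets and their [(r-1)]-subsets *)

Section Facets.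
Variables (U : finType) (r : nat).
Hypothesis r_gt1 : (1 < r)%N.
Implicit Types (e b : {set U}) (G S : {set {set U}}).

Definition facets e : {set {set U}} := [set b in ksets U r.-1 | b \subset e].

Lemma in_facets e b : (b \in facets e) = (#|b| == r.-1) && (b \subset e).
Proof. by rewrite !inE. Qed.

Lemma card_facets e : #|e| = r -> #|facets e| = r.
Proof.
move=> er; have -> : facets e = [set b : {set U} | b \subset e & #|b| == r.-1].
  by apply/setP => b; rewrite in_facets inE andbC.
rewrite cards_draws er -[X in 'C(X, _)](prednK (ltnW r_gt1)) binSn.
by rewrite prednK // ltnW.
Qed.

(** Hence the hypergraph of facets is linear. *)
Lemma facets_setU e b b' : #|e| = r -> b != b' -> b \in facets e -> b' \in facets e ->
  e = b :|: b'.
Proof.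
move=> er bb'; rewrite !in_facets => /andP[/eqP bk be] /andP[/eqP b'k b'e].
apply/esym/eqP; rewrite eqEcard finset.subUset be b'e er /=.
have : b \proper b :|: b'.
  rewrite properE finset.subsetUl finset.subUset fintype.subxx /=.
  apply: contra bb' => b'b; rewrite eq_sym eqEcard b'b bk b'k //=.
move/proper_card; rewrite bk; apply: leq_trans.
by rewrite prednK // ltnW.
Qed.

Lemma count_enum (A : {set {set U}}) (P : pred {set U}) :
  count P (enum A) = #|[set e in A | P e]|.
Proof.
rewrite cardE -size_filter; apply/perm_size/uniq_perm.
- by apply: filter_uniq; apply: enum_uniq.
- exact: enum_uniq.
- by move=> e; rewrite mem_filter !mem_enum inE andbC.
Qed.

Lemma facets_linear_regular :
  linear_regular (enum (ksets U r)) facets (ksets U r.-1) r (#|U| - r.-1).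
Proof.
split.
- exact: enum_uniq.
- by move=> e _; apply/fintype.subsetP => b; rewrite inE => /andP[].
- by move=> e; rewrite mem_enum inE => /eqP; apply: card_facets.
- move=> b b' bb'; rewrite count_enum.
  apply: (@leq_trans #|[set b :|: b']|); last by rewrite cards1.
  apply: subset_leq_card; apply/fintype.subsetP => e.
  rewrite inE => /andP[eX /andP[be b'e]]; rewrite inE; apply/eqP.
  by apply: facets_setU bb' be b'e; move: eX; rewrite inE => /eqP.
- move=> b bX; have bk : #|b| = r.-1 by move: bX; rewrite inE => /eqP.
  rewrite count_enum.
  have -> : [set e in ksets U r | b \in facets e] = [set x |: b | x in ~: b].
    apply/setP => e; rewrite !inE bk eqxx /=; apply/andP/imsetP.
      move=> [/eqP er be]; have : (0 < #|e :\: b|)%N.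
        by rewrite cardsD (finset.setIidPr be) er bk subn_gt0 ltn_predL; apply: ltnW.
      case/card_gt0P => x; rewrite inE => /andP[xb xe].
      exists x; first by rewrite inE.
      apply/esym/eqP; rewrite eqEcard finset.subUset finset.sub1set xe be /=.
      by rewrite cardsU1 xb bk er add1n prednK // ltnW.
    case=> x; rewrite inE => xb ->; rewrite finset.subsetUr cardsU1 xb bk add1n.
    by rewrite prednK ?eqxx // ltnW.
  rewrite card_in_imset; first by rewrite cardsCs finset.setCK bk.
  move=> x y.
  rewrite !inE => xb yb /setP/(_ x); rewrite !inE eqxx (negbTE xb) !orbF.
  by move/esym/eqP.
Qed.

Lemma matchnum_le_nu G : G \subset ksets U r -> (matchnum facets G <= nu r.-1 G)%N.
Proof.
move=> Gr; have [K [KG /matchingP mK <-]] := matchnum_witness facets G.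
suff mK' : is_matching r.-1 G K by rewrite /nu (bigop.bigmax_sup K) ?mK'.
rewrite /is_matching KG; apply/forall_inP => e eK; apply/forall_inP => f fK.
apply/implyP => ef; rewrite ltnNge; apply/negP => le_ef.
have : (0 < #|[set b : {set U} | b \subset e :&: f & #|b| == r.-1]|)%N.
  by rewrite cards_draws bin_gt0.
case/card_gt0P => b; rewrite inE finset.subsetI => /andP[/andP[be bf] bk].
have := mK e f eK fK ef; rewrite finset.disjoints_subset => /fintype.subsetP/(_ b).
by rewrite finset.in_setC !in_facets be bf bk => /(_ isT).
Qed.

Lemma tau_le_cover_cost G S : G \subset ksets U r -> S \subset ksets U r.-1 ->
  (tau r.-1 G <= cover_cost facets S G)%N.
Proof.
move=> Gr SX; have r1r : (r.-1 <= r)%N by apply: leq_pred.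
have [_ minS] := tauP r1r Gr.
pose N := [set e in G | [disjoint facets e & S]].
pose f e := odflt finset.set0 [pick b in facets e].
apply: leq_trans (minS (S :|: f @: N) _) _; last first.
  apply: leq_trans (leq_card_setU _ _).1 _; rewrite leq_add2l; exact: leq_imset_card.
have fP e : e \in G -> f e \in facets e.
  move=> eG; rewrite /f; case: pickP => //= none.
  have er : #|e| = r by have := fintype.subsetP Gr e eG; rewrite inE => /eqP.
  have := card_facets er; rewrite eq_card0 // => r0.
  by move: r_gt1; rewrite -r0.
apply/andP; split.
  rewrite finset.subUset SX; apply/fintype.subsetP => b /imsetP[e].
  by rewrite inE => /andP[/fP + _] ->; rewrite inE => /andP[].
apply/forall_inP => e eG; apply/exists_inP.
have [dS|] := boolP [disjoint facets e & S].
  exists (f e); last by have := fP e eG; rewrite in_facets => /andP[].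
  by rewrite inE orbC imset_f // inE eG.
case/pred0Pn => b /andP[]; rewrite /= in_facets => /andP[_ be] bS.
by exists b; rewrite // inE bS.
Qed.

Lemma card_ksets k : #|ksets U k| = 'C(#|U|, k).
Proof.
by rewrite /ksets -card_draws; apply: eq_card => b; rewrite !inE.
Qed.

End Facets.

(** A crude bound that makes the number of vertices large against the degree when
    [r >= 3]. *)
Lemma sub_leq_bin a b : (0 < b)%N -> (a - b <= 'C(a, b))%N.
Proof.
elim: a b => [|a IH] [|b] // _; rewrite subSS binS.
have [ba|ab] := leqP b a; last by rewrite (eqP (_ : a - b == 0)%N) // subn_eq0 ltnW.
have b0 : (0 < 'C(a, b))%N by rewrite bin_gt0.
by have := IH b.+1 isT; rewrite subnS; lia.
Qed.

Lemma rgraph_probE (R : realType) (r n : nat) (p : R) (P : pred {set {set 'I_n}}) :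
  rgraph_prob r p P = Ex p (enum (ksets 'I_n r)) (fun G => (P G)%:R).
Proof.
rewrite -ExE /rgraph_prob /rgraph_weight big_mkcondr; apply: eq_bigr => G _.
by case: (P G); rewrite ?mulr1 ?mulr0.
Qed.

(** * Random hypergraphs *)

Section WithHighProbability.
Variables (R : realType) (r : nat).
Hypothesis r_gt2 : (2 < r)%N.

Lemma whp_cover_parameters (C1 C theta u1 : R) (l : nat) (p : nat -> R) :
  cover_parameters r C1 theta u1 (l.+1%:R^-1 + (1 - l.+1%:R^-1) ^+ r.-1) ->
  C1 < C -> 1 <= C * r%:R -> (forall n, 0 <= p n <= 1) ->
  whp r p (fun n G => (tau r.-1 G)%:R <= C * r%:R * (nu r.-1 G)%:R).
Proof.
move=> cp C1C Cr p01; apply/cvgrPdist_le => delta delta0.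
have [D0 few] := few_failures r_gt2 cp C1C Cr delta0.
exists (D0 + r + r.-1 * D0)%N => // n /= nlarge.
have r_gt1 : (1 < r)%N by apply: ltnW.
have [S0 [S0X S0cov S0card]] := small_cover 'I_n l r_gt1 R.
have lr := facets_linear_regular 'I_n r_gt1.
rewrite card_ord in lr.
have D0D : (D0 <= n - r.-1)%N by lia.
have XD0 : (D0 * (n - r.-1) <= #|ksets 'I_n r.-1|)%N.
  rewrite card_ksets card_ord.
  have m0 : (0 < r.-1)%N by lia.
  rewrite -(leq_pmul2l m0).
  have -> : (r.-1 * 'C(n, r.-1) = n * 'C(n.-1, r.-2))%N.
    by rewrite -{1 2}(prednK m0) -mul_bin_diag; lia.
  have : (n.-1 - r.-2 <= 'C(n.-1, r.-2))%N by apply: sub_leq_bin; lia.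
  have -> : (n.-1 - r.-2 = n - r.-1)%N by lia.
  by move=> h; rewrite mulnA; apply: leq_mul; lia.
have S0f e : e \in enum (ksets 'I_n r) -> ~~ [disjoint facets r e & S0].
  rewrite mem_enum => /S0cov[b bS be]; apply/pred0Pn; exists b; rewrite /= bS andbT.
  by rewrite inE be andbT (fintype.subsetP S0X).
have [S SX hS] := few _ _ _ _ _ _ _ lr D0D XD0 S0X S0f S0card (p n) (p01 n).
have P1 : rgraph_prob r (p n) (fun G : {set {set 'I_n}} => (tau r.-1 G)%:R <= C * r%:R * (nu r.-1 G)%:R) <= 1.
  rewrite rgraph_probE -[leRHS](Ex_cst (p n) (enum (ksets 'I_n r))).
  by apply: le_Ex => // G _; rewrite lern1 leq_b1.
rewrite ger0_norm ?subr_ge0 // lerBlDr -lerBlDl.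
apply: le_trans (lerB (lexx 1) hS) _.
rewrite rgraph_probE -[X in X - _ <= _](Ex_cst (p n) (enum (ksets 'I_n r))) -ExB.
apply: le_Ex => // G Gs.
have Gr : G \subset ksets 'I_n r by apply/fintype.subsetP => e /Gs; rewrite mem_enum.
have [//|fail] := boolP ((tau r.-1 G)%:R <= C * r%:R * (nu r.-1 G)%:R).
  by rewrite gerBl.
rewrite -ltNge in fail; rewrite (_ : _ < _ = true) ?subrr //.
apply: le_lt_trans (lt_le_trans fail _); last by rewrite ler_nat tau_le_cover_cost.
by rewrite ler_wpM2l ?(le_trans ler01) // ler_nat matchnum_le_nu.
Qed.

End WithHighProbability.

(** * Choice of the parameters *)

Section ParameterChoice.
Variable R : realType.

Lemma expR1_le4 : expR 1 <= 4 :> R.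
Proof.
have h : expR (2^-1) <= 2 :> R.
  rewrite -[leLHS]invrK -expRN -[leRHS]invrK lef_pV2 ?posrE ?invr_gt0 ?expR_gt0 //.
  by have := expR_ge1Dx (- 2^-1 : R); lra.
have -> : 1 = 2^-1 + 2^-1 :> R by lra.
rewrite expRD; have := expR_gt0 (2^-1 : R); nra.
Qed.

(** By passing from [u] to [theta u = (1 + 1/r) u] the random cover saves [u / r]
    and pays at most [4 u / (r (r-1))]; the balance is positive once [r > 5]. Two
    colours make a full cover of density at most [17/32], less than [1 - u1]. *)
Lemma parameters_ge6 (r : nat) : (6 <= r)%N ->
  cover_parameters r (1 - (8 * r%:R)^-1) (1 + r%:R^-1) (7 / 16 : R)
    (2%:R^-1 + (1 - 2%:R^-1) ^+ r.-1).
Proof.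
move=> r6.
have r0 : 0 < r%:R :> R by rewrite ltr0n; apply: leq_trans r6.
have r6' : 6 <= r%:R :> R by rewrite (ler_nat _ 6).
have rE : r%:R = r.-1%:R + 1 :> R by rewrite natr1 prednK //; apply: leq_trans r6.
have ri0 : 0 < r%:R^-1 :> R by rewrite invr_gt0.
have ri6 : r%:R^-1 <= 6^-1 :> R by rewrite lef_pV2 ?posrE.
have e8 : (8 * r%:R)^-1 = 8^-1 * r%:R^-1 :> R by rewrite invfM.
have th : (1 + r%:R^-1) ^+ r <= 4 :> R.
  apply: le_trans expR1_le4; apply: growth_le_expR; first exact: ltW.
  by rewrite divff // gt_eqF.
have th1 : 1 <= 1 + r%:R^-1 :> R by rewrite lerDl ltW.
split; rewrite ?e8.
- by apply/andP; split; lra.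
- by [].
- by apply/andP; split; lra.
- apply: (@le_trans _ _ ((1 + r%:R^-1) ^+ r)).
    by apply: ler_weXn2l => //; apply: leq_pred.
  apply: le_trans th _; rewrite mulrBr mulr1 [8^-1 * _]mulrC mulrA divff ?gt_eqF // mul1r.
  lra.
- have m5 : 5 <= r.-1%:R :> R by lra.
  have m0 : 0 < r.-1%:R :> R by lra.
  have w : (1 + r%:R^-1) ^+ r / (r%:R * r.-1%:R) <= 4 / 5 * r%:R^-1 :> R.
    rewrite invfM mulrA mulrAC; apply: ler_wpM2r; first exact: ltW.
    by rewrite ler_pdivrMr //; lra.
  lra.
- have h : (1 - 2%:R^-1) ^+ r.-1 <= (2%:R^-1) ^+ 5 :> R.
    rewrite (_ : 1 - 2%:R^-1 = 2%:R^-1); last by lra.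
    apply: ler_wiXn2l; [lra | lra | by rewrite -ltnS prednK // (leq_trans _ r6)].
  have h5 : (2%:R^-1) ^+ 5 = 32^-1 :> R by rewrite exprVn -natrX.
  rewrite h5 in h; lra.
Qed.

(** Let [a = ln (r/2) / r]. Then [theta = 1 + a] satisfies [theta ^ r <= r / 2], so
    one vertex of each edge gives a good enough cover while [theta u >= 1]; below
    that the random cover saves about [a], at least half of [1 - u] as long as
    [1 - u <= 2 a]; and beyond [u1 = 1 - 2 a] a full cover with about [1 / a]
    colours has density close to [a], the sets that miss some colour counting for
    [2 / r] only. *)
Lemma parameters_large (eps : R) : 0 < eps -> eps <= 4^-1 ->
  exists r0 : nat, forall r, (r0 <= r)%N -> exists theta u1 : R, exists l : nat,
  cover_parameters r (2^-1 + eps) theta u1 (l.+1%:R^-1 + (1 - l.+1%:R^-1) ^+ r.-1).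
Proof.
move=> eps0 eps4.
exists (Num.bound (2 * expR (8 / eps))) => r rlarge.
have hr : 2 * expR (8 / eps) <= r%:R.
  apply: le_trans (ltW (archi_boundP _)) _; first by rewrite mulr_ge0 ?expR_ge0.
  by rewrite ler_nat.
have e80 : 0 < expR (8 / eps) := expR_gt0 _.
have r0 : 0 < r%:R :> R by lra.
have r_gt0 : (0 < r)%N by rewrite -(ltr0n R).
pose t := ln (r%:R / 2 : R).
have et : expR t = r%:R / 2 by rewrite lnK // posrE divr_gt0.
have t8 : 8 / eps <= t by rewrite -ler_expR et; lra.
have te : 8 <= t * eps by rewrite -ler_pdivrMr.
have t32 : 32 <= t by nra.
have t0 : 0 < t by lra.
have rt : t ^+ 2 <= r%:R.
  have := @expR_ge1Dxn R t 1 (ltW t0); rewrite et.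
  by rewrite (_ : 2`! = 2)%N //; lra.
pose a := t / r%:R.
have ra : r%:R * a = t by rewrite /a mulrC divfK // gt_eqF.
have a0 : 0 < a by rewrite divr_gt0.
have ae : a <= eps / 8.
  by rewrite /a ler_pdivrMr //; nra.
have th : (1 + a) ^+ r <= r%:R / 2.
  by rewrite -et; apply: growth_le_expR; rewrite ?ra // ltW.
have rE : r%:R = r.-1%:R + 1 :> R by rewrite natr1 prednK.
have re : 8 <= r.-1%:R * eps by nra.
have m0 : 0 < r.-1%:R :> R by nra.
pose y := ((1 + eps) * a)^-1.
have ea0 : 0 < (1 + eps) * a by rewrite mulr_gt0 // addr_gt0.
have y1 : 1 <= y by rewrite /y invf_ge1 //; nra.
have y0 : 0 <= y by lra.
have /andP[ly yl] := truncn_itv y0.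
have l_gt0 : (0 < Num.truncn y)%N by rewrite truncn_gt0.
exists (1 + a), (1 - 2 * a), (Num.truncn y).-1; rewrite prednK //.
set l := Num.truncn y in ly yl l_gt0 *.
have l0 : 0 < l%:R :> R by rewrite ltr0n.
have li1 : (1 + eps) * a <= l%:R^-1.
  by rewrite -[leLHS]invrK lef_pV2 ?posrE // invr_gt0.
have li2 : l%:R^-1 <= (1 + 3 / 2 * eps) * a.
  have ya : y * ((1 + eps) * a) = 1 by rewrite mulVf // gt_eqF.
  rewrite -[leLHS]mul1r ler_pdivrMr //.
  have : (y - 1) * ((1 + 3 / 2 * eps) * a) <= (1 + 3 / 2 * eps) * a * l%:R.
    rewrite mulrC ler_wpM2l; [by [] | | by rewrite -natr1 in yl; lra].
    by rewrite mulr_ge0 ?ltW //; lra.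
  have : 1 <= (y - 1) * ((1 + 3 / 2 * eps) * a).
    pose z := y * a; have z1 : z * (1 + eps) = 1 by rewrite -[RHS]ya /z; ring.
    have z0 : 4 / 5 <= z by nra.
    have z2 : 4 / 5 * eps <= z * eps by rewrite ler_wpM2r // ltW.
    have a4 : eps * a <= 4^-1 * a by rewrite ler_wpM2r // ltW.
    have -> : (y - 1) * ((1 + 3 / 2 * eps) * a) = z * (1 + eps) + z * eps / 2 - a - 3 / 2 * (eps * a).
      by rewrite /z; field.
    lra.
  lra.
have pw : (1 - l%:R^-1) ^+ r.-1 <= 2 / r%:R :> R.
  have -> : 2 / r%:R = expR (- t) :> R by rewrite expRN et invf_div.
  apply: (@le_trans _ _ (expR (- l%:R^-1) ^+ r.-1)).
    apply: lerXn2r; rewrite ?nnegrE ?expR_ge0 ?expR_ge1Dx // subr_ge0 invf_le1 // ler1n //.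
  rewrite -expRM_natl ler_expR mulrN lerN2.
  apply: le_trans (ler_wpM2l (ltW m0) li1).
  rewrite -ra rE; nra.
split.
- by apply/andP; split; lra.
- by rewrite lerDl ltW.
- by apply/andP; split; lra.
- apply: (@le_trans _ _ ((1 + a) ^+ r)).
    by apply: ler_weXn2l; rewrite ?leq_pred // lerDl ltW.
  by apply: le_trans th _; rewrite ler_wpM2l ?(ltW r0) //; lra.
- have w : (1 + a) ^+ r / (r%:R * r.-1%:R) <= eps * a.
    rewrite ler_pdivrMr ?mulr_gt0 //; apply: le_trans th _.
    have -> : eps * a * (r%:R * r.-1%:R) = (t * eps) * r.-1%:R by rewrite -ra; ring.
    have m1 : 1 <= r.-1%:R :> R by nra.
    have : 8 * r.-1%:R <= t * eps * r.-1%:R by rewrite ler_wpM2r.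
    lra.
  nra.
- have w : 2 / r%:R <= eps / 2 * a.
    rewrite ler_pdivrMr //.
    have -> : eps / 2 * a * r%:R = t * eps / 2 by rewrite -ra; field.
    lra.
  lra.
Qed.

End ParameterChoice.

Theorem theorem1p7 (R : realType) :
  (exists2 C : R, C < 1 &
    forall (r : nat) (p : nat -> R), (6 <= r)%N ->
      (forall n, 0 <= p n <= 1) ->
      whp r p (fun n G =>
        (tau r.-1 G)%:R <= C * r%:R * (nu r.-1 G)%:R))
  /\
  (forall eps : R, 0 < eps ->
    exists r0 : nat, forall (r : nat) (p : nat -> R), (r0 <= r)%N ->
      (forall n, 0 <= p n <= 1) ->
      whp r p (fun n G =>
        (tau r.-1 G)%:R <= (2^-1 + eps) * r%:R * (nu r.-1 G)%:R)).
Proof.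
split; last first.
  move=> eps eps0.
  pose e := Num.min (eps / 2) 4^-1.
  have e0 : 0 < e by rewrite lt_min divr_gt0 //= invr_gt0.
  have e4 : e <= 4^-1 by rewrite ge_min lexx orbT.
  have ee : e < eps.
    by apply: le_lt_trans (_ : _ <= eps / 2) _; [rewrite ge_min lexx | lra].
  have [r0 par] := parameters_large e0 e4.
  exists (r0 + 3)%N => r p rlarge p01.
  have [theta [u1 [l cp]]] := par r (leq_trans (leq_addr _ _) rlarge).
  have r3 : (2 < r)%N by apply: leq_trans rlarge; rewrite leq_addl.
  apply: (whp_cover_parameters r3 cp) => //; first by rewrite ltrD2l.
  have : 3 <= r%:R :> R by rewrite (ler_nat _ 3).
  nra.
have e0 : 0 < 8^-1 :> R by rewrite invr_gt0.
have e4 : 8^-1 <= 4^-1 :> R by rewrite lef_pV2 ?posrE // ler_nat.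
have [r0 par] := parameters_large e0 e4.
have r0' : 1 <= r0.+1%:R :> R by rewrite ler1n.
pose x : R := (16 * r0.+1%:R)^-1.
have x0 : 0 < x by rewrite invr_gt0; lra.
have x1 : x <= 16^-1 by rewrite lef_pV2 ?posrE //; lra.
exists (1 - x); first by rewrite gtrBl.
move=> r p r6 p01.
have r3 : (2 < r)%N by apply: leq_trans r6.
have r6' : 6 <= r%:R :> R by rewrite (ler_nat _ 6).
have Cr : 1 <= (1 - x) * r%:R by nra.
have [large|small] := leqP r0 r.
  have [theta [u1 [l cp]]] := par r large.
  by apply: (whp_cover_parameters r3 cp) => //; lra.
apply: (whp_cover_parameters r3 (parameters_ge6 R r6) (l := 1)) => //.
have p8 : 0 < 8 * r%:R :> R by lra.
have p16 : 0 < 16 * r0.+1%:R :> R by lra.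
rewrite ltrD2l ltrN2 ltf_pV2 ?posrE //.
have : r%:R < r0.+1%:R :> R by rewrite ltr_nat ltnS ltnW.
lra.
Qed.
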